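(* Let $E$ be an (a,b)-module, let $F:=E/bE$ with its $\mathbb{C}$-linear endomorphism induced by $a$, and for each eigenvalue $v$ of $a$ on $F$ let $F_v\subset F$ be the corresponding spectral (generalized eigen-) subspace and $d(v)$ the multiplicity of the root $v$ in the minimal polynomial of the action of $a$ on $F$. Then for each eigenvalue $v$ there exists a normal submodule $G_v$ of $E$ such that $G_v/bG_v\simeq F_v$ and such that $(a-v)^{d(v)}G_v\subset bG_v$. Moreover $G_v$ is of rank $\dim_{\mathbb{C}}F_v$, and $E$ decomposes as a direct sum of (a,b)-modules $$E=\oplus_v\,G_v,$$ where $v$ runs over the eigenvalues of $a$ on $F$.
   Context: $\mathcal{A}=\mathbb{C}\langle a,b\rangle$ is the unital $\mathbb{C}$-algebra generated by $a,b$ with the relation $ab-ba=b^2$; $\tilde{\mathcal{A}}$ is its completion for the $b$-adic filtration given by the two-sided ideals $b^\nu\mathcal{A}$, $\nu\in\mathbb{N}$. An (a,b)-module is a left $\tilde{\mathcal{A}}$-module which is free of finite rank over the commutative subalgebra $\mathbb{C}[[b]]\subset\tilde{\mathcal{A}}$; its rank is its rank over $\mathbb{C}[[b]]$. For an (a,b)-module $E$, the subspace $bE$ is stable under $a$, so $a$ acts on the finite-dimensional space $E/bE$. A submodule $G\subset E$ (left $\tilde{\mathcal{A}}$-submodule) is normal if $G\cap bE=bG$. *)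

(* Defs.v *)
From HB Require Import structures.
From mathcomp Require Import all_boot all_order all_algebra.
From mathcomp Require Import generic_quotient ring_quotient.
From mathcomp Require Import boolp functions reals complex monalg.

Set Implicit Arguments.
Unset Strict Implicit.
Unset Printing Implicit Defensive.

Import GRing.Theory.

Local Open Scope ring_scope.
Local Open Scope quotient_scope.

Record ideal2 (A : pzRingType) := Ideal2 {
  ideal2_pred :> {pred A};
  ideal2_zmod : zmod_closed ideal2_pred;
  ideal2Ml : forall a x, x \in ideal2_pred -> a * x \in ideal2_pred;
  ideal2Mr : forall a x, x \in ideal2_pred -> x * a \in ideal2_pred }.

HB.instance Definition _ (A : pzRingType) (I : ideal2 A) :=
  GRing.isZmodClosed.Build A (ideal2_pred I) (ideal2_zmod I).

Section RingQuotientType.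
Variables (A : pzRingType) (I : ideal2 A).

Definition ringquot : Type := Quotient.quot (ideal2_pred I).

HB.instance Definition _ := GRing.Zmodule.on ringquot.

End RingQuotientType.

(* Locked, so that unification does not unfold nested quotients. *)
HB.lock Definition ringquot_pi (A : pzRingType) (I : ideal2 A) (x : A) :
  ringquot I := \pi_(Quotient.quot (ideal2_pred I)) x.

HB.lock Definition ringquot_repr (A : pzRingType) (I : ideal2 A)
  (x : ringquot I) : A := repr (x : Quotient.quot (ideal2_pred I)).

HB.lock Definition ringquot_mul (A : pzRingType) (I : ideal2 A)
  (x y : ringquot I) : ringquot I :=
  ringquot_pi I (ringquot_repr x * ringquot_repr y).

Section RingQuotient.
Variables (A : pzRingType) (I : ideal2 A).

Local Notation ringquot := (ringquot I).
Local Notation ringquot_pi := (@ringquot_pi A I).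
Local Notation ringquot_mul := (@ringquot_mul A I).

Lemma ringquot_piB : zmod_morphism ringquot_pi.
Proof. by move=> x y; rewrite unlock; apply: raddfB. Qed.

HB.instance Definition _ :=
  GRing.isZmodMorphism.Build A ringquot ringquot_pi ringquot_piB.

Lemma ringquot_pi_eq x y : ringquot_pi x = ringquot_pi y <-> x - y \in I.
Proof.
rewrite (Quotient.idealrBE (ideal2_pred I)) unlock.
by split=> [e|/eqP e]; [apply/eqP|].
Qed.

Lemma ringquot_piK (x : ringquot) : ringquot_pi (ringquot_repr x) = x.
Proof. by rewrite ringquot_pi.unlock ringquot_repr.unlock reprK. Qed.

Lemma ringquot_piM x y :
  ringquot_pi (x * y) = ringquot_mul (ringquot_pi x) (ringquot_pi y).
Proof.
rewrite ringquot_mul.unlock; apply/ringquot_pi_eq.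
set x' := ringquot_repr _; set y' := ringquot_repr _.
have xI : x - x' \in I by apply/ringquot_pi_eq; rewrite ringquot_piK.
have yI : y - y' \in I by apply/ringquot_pi_eq; rewrite ringquot_piK.
have -> : x * y - x' * y' = (x - x') * y + x' * (y - y').
  by rewrite mulrBl mulrBr addrA subrK.
exact: (rpredD (ideal2Mr _ xI) (ideal2Ml _ yI)).
Qed.

Lemma ringquot_ind (P : ringquot -> Prop) :
  (forall x, P (ringquot_pi x)) -> forall x, P x.
Proof. by move=> h x; rewrite -[x]ringquot_piK. Qed.

Fact ringquot_mulA : associative ringquot_mul.
Proof.
elim/ringquot_ind=> x; elim/ringquot_ind=> y; elim/ringquot_ind=> z.
by rewrite -!ringquot_piM mulrA.
Qed.

Fact ringquot_mul1 : left_id (ringquot_pi 1) ringquot_mul.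
Proof. by elim/ringquot_ind=> x; rewrite -ringquot_piM mul1r. Qed.

Fact ringquot_1mul : right_id (ringquot_pi 1) ringquot_mul.
Proof. by elim/ringquot_ind=> x; rewrite -ringquot_piM mulr1. Qed.

Fact ringquot_mulDl : left_distributive ringquot_mul +%R.
Proof.
elim/ringquot_ind=> x; elim/ringquot_ind=> y; elim/ringquot_ind=> z.
by rewrite -raddfD -!ringquot_piM mulrDl raddfD.
Qed.

Fact ringquot_mulDr : right_distributive ringquot_mul +%R.
Proof.
elim/ringquot_ind=> x; elim/ringquot_ind=> y; elim/ringquot_ind=> z.
by rewrite -raddfD -!ringquot_piM mulrDr raddfD.
Qed.

HB.instance Definition _ := GRing.Zmodule_isPzRing.Build ringquot
  ringquot_mulA ringquot_mul1 ringquot_1mul ringquot_mulDl ringquot_mulDr.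

Fact ringquot_pi_monoid : monoid_morphism ringquot_pi.
Proof. by split=> // x y; rewrite ringquot_piM. Qed.

HB.instance Definition _ :=
  GRing.isMonoidMorphism.Build A ringquot ringquot_pi ringquot_pi_monoid.

End RingQuotient.

Section GeneratedIdeal.
Variables (A : pzRingType) (r : A).

Definition gen_ideal_pred : {pred A} :=
  [pred x | `[< forall I : ideal2 A, r \in I -> x \in I >]].

Fact gen_ideal_zmod : zmod_closed gen_ideal_pred.
Proof.
split=> [|x y /asboolP xI /asboolP yI]; apply/asboolP=> I rI.
  exact: rpred0.
by rewrite rpredB ?xI ?yI.
Qed.

Fact gen_idealMl a x : x \in gen_ideal_pred -> a * x \in gen_ideal_pred.
Proof. by move=> /asboolP xI; apply/asboolP=> I rI; apply/ideal2Ml/xI. Qed.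

Fact gen_idealMr a x : x \in gen_ideal_pred -> x * a \in gen_ideal_pred.
Proof. by move=> /asboolP xI; apply/asboolP=> I rI; apply/ideal2Mr/xI. Qed.

Definition gen_ideal := Ideal2 gen_ideal_zmod gen_idealMl gen_idealMr.

End GeneratedIdeal.

Record submod (A : pzRingType) (M : lmodType A) := Submod {
  submod_pred :> {pred M};
  submod_closedP : GRing.submod_closed submod_pred }.

HB.instance Definition _ (A : pzRingType) (M : lmodType A) (N : submod M) :=
  GRing.isSubmodClosed.Build A M (submod_pred N) (submod_closedP N).

Section SubModule.
Variables (A : pzRingType) (M : lmodType A) (N : submod M).

Definition sub_lmod : Type := {x : M | x \in submod_pred N}.

HB.instance Definition _ := SubType.on sub_lmod.
HB.instance Definition _ := Choice.on sub_lmod.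
HB.instance Definition _ := [SubChoice_isSubLmodule of sub_lmod by <:].

Definition quot_lmod : Type := Quotient.quot (submod_pred N).

HB.instance Definition _ := GRing.Zmodule.on quot_lmod.

End SubModule.

HB.lock Definition quot_pi (A : pzRingType) (M : lmodType A) (N : submod M)
  (x : M) : quot_lmod N := \pi_(Quotient.quot (submod_pred N)) x.

HB.lock Definition quot_repr (A : pzRingType) (M : lmodType A) (N : submod M)
  (x : quot_lmod N) : M := repr (x : Quotient.quot (submod_pred N)).

Section QuotientModule.
Variables (A : pzRingType) (M : lmodType A) (N : submod M).

Local Notation quot_lmod := (quot_lmod N).
Local Notation quot_pi := (@quot_pi A M N).
Local Notation quot_repr := (@quot_repr A M N).

Lemma quot_piB : zmod_morphism quot_pi.
Proof. by move=> x y; rewrite unlock; apply: raddfB. Qed.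

HB.instance Definition _ :=
  GRing.isZmodMorphism.Build M quot_lmod quot_pi quot_piB.

Lemma quot_pi_eq x y : quot_pi x = quot_pi y <-> x - y \in N.
Proof.
rewrite (Quotient.idealrBE (submod_pred N)) unlock.
by split=> [e|/eqP e]; [apply/eqP|].
Qed.

Lemma quot_piK (x : quot_lmod) : quot_pi (quot_repr x) = x.
Proof. by rewrite quot_pi.unlock quot_repr.unlock reprK. Qed.

Lemma quot_ind (P : quot_lmod -> Prop) :
  (forall x, P (quot_pi x)) -> forall x, P x.
Proof. by move=> h x; rewrite -[x]quot_piK. Qed.

Definition quot_scale (c : A) (x : quot_lmod) : quot_lmod :=
  quot_pi (c *: quot_repr x).

Lemma quot_piZ c x : quot_pi (c *: x) = quot_scale c (quot_pi x).
Proof.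
apply/quot_pi_eq; rewrite -scalerBr rpredZ //.
by apply/quot_pi_eq; rewrite quot_piK.
Qed.

Fact quot_scaleA a b x :
  quot_scale a (quot_scale b x) = quot_scale (a * b) x.
Proof. by elim/quot_ind: x => x; rewrite -!quot_piZ scalerA. Qed.

Fact quot_scale1 : left_id 1 quot_scale.
Proof. by elim/quot_ind=> x; rewrite -quot_piZ scale1r. Qed.

Fact quot_scaleDr : right_distributive quot_scale +%R.
Proof.
by move=> a; elim/quot_ind=> x; elim/quot_ind=> y;
  rewrite -raddfD -!quot_piZ scalerDr raddfD.
Qed.

Fact quot_scaleDl x : {morph quot_scale^~ x : a b / a + b}.
Proof. by elim/quot_ind: x => x a b; rewrite -!quot_piZ scalerDl raddfD. Qed.

HB.instance Definition _ := GRing.Zmodule_isLmodule.Build A quot_lmod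
  quot_scaleA quot_scale1 quot_scaleDr quot_scaleDl.

Fact quot_pi_scalable : scalable quot_pi.
Proof. by move=> c x; rewrite quot_piZ. Qed.

HB.instance Definition _ :=
  GRing.isScalable.Build A M quot_lmod *:%R quot_pi quot_pi_scalable.

Section InducedEndo.
Variable f : {linear M -> M}.
Hypothesis f_stable : forall x, x \in N -> f x \in N.

Definition quot_endo_fun (x : quot_lmod) : quot_lmod :=
  quot_pi (f (quot_repr x)).

Lemma quot_endo_pi x : quot_endo_fun (quot_pi x) = quot_pi (f x).
Proof.
apply/quot_pi_eq; rewrite -raddfB f_stable //.
by apply/quot_pi_eq; rewrite quot_piK.
Qed.

Fact quot_endo_linear : linear quot_endo_fun.
Proof.
move=> c; elim/quot_ind=> x; elim/quot_ind=> y.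
by rewrite -linearP !quot_endo_pi !linearP.
Qed.

Definition quot_endo : {linear quot_lmod -> quot_lmod} :=
  HB.pack quot_endo_fun
    (GRing.isLinear.Build A quot_lmod quot_lmod *:%R quot_endo_fun
       quot_endo_linear).

End InducedEndo.
End QuotientModule.

Section RestrictScalars.
Variables (K A : pzRingType) (phi : {rmorphism K -> A}) (E : lmodType A).

Definition res_scalars_type : Type := E.
HB.instance Definition _ := GRing.Zmodule.on res_scalars_type.

Definition res_scale (c : K) (x : res_scalars_type) : res_scalars_type :=
  phi c *: (x : E).

Fact res_scaleA c d x : res_scale c (res_scale d x) = res_scale (c * d) x.
Proof. by rewrite /res_scale scalerA -rmorphM. Qed.

Fact res_scale1 : left_id 1 res_scale.
Proof. by move=> x; rewrite /res_scale rmorph1 scale1r. Qed.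

Fact res_scaleDr : right_distributive res_scale +%R.
Proof. by move=> c x y; rewrite /res_scale scalerDr. Qed.

Fact res_scaleDl x : {morph res_scale^~ x : c d / c + d}.
Proof. by move=> c d; rewrite /res_scale rmorphD scalerDl. Qed.

Definition res_scalars : lmodType K :=
  HB.pack res_scalars_type
    (GRing.Zmodule_isLmodule.Build K res_scalars_type
       res_scaleA res_scale1 res_scaleDr res_scaleDl).

Definition res_act_fun (t : A) (x : res_scalars) : res_scalars := t *: (x : E).

Section Central.
Variables (t : A) (t_central : forall c, phi c * t = t * phi c).

Fact res_act_linear : linear (res_act_fun t).
Proof.
move=> c x y; rewrite /res_act_fun.
transitivity (t *: (phi c *: (x : E) + y)) => //.
by rewrite scalerDr scalerA -t_central -scalerA.
Qed.

Definition res_act : {linear res_scalars -> res_scalars} :=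
  HB.pack (res_act_fun t)
    (GRing.isLinear.Build K res_scalars res_scalars *:%R (res_act_fun t)
       res_act_linear).

End Central.
End RestrictScalars.

Section LinearAlgebra.
Variables (K : fieldType) (V : lmodType K) (f : {linear V -> V}).
Implicit Types (v : K) (p : {poly K}).

Definition is_eigenvalue v := exists2 x, x != 0 & f x = v *: x.

Definition shift_endo v (x : V) : V := f x - v *: x.

(* The generalized eigenspace of f at v: the union of the ker (f - v)^k. *)
Definition spectral_pred v : {pred V} :=
  [pred x | `[< exists k, iter k (shift_endo v) x = 0 >]].

Lemma shift_endo_linear v : linear (shift_endo v).
Proof.
move=> c x y; rewrite /shift_endo linearP scalerDr opprD addrACA.
by rewrite scalerBr !scalerA mulrC.
Qed.

Lemma iter_shift_linear v k : linear (iter k (shift_endo v)).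
Proof. by elim: k => // k IH c x y; rewrite !iterS IH shift_endo_linear. Qed.

Lemma iter_shift0 v k : iter k (shift_endo v) 0 = 0.
Proof. by elim: k => //= k ->; rewrite /shift_endo linear0 scaler0 subr0. Qed.

Fact spectral_closed v : GRing.submod_closed (spectral_pred v).
Proof.
split=> [|c x y /asboolP[k xk] /asboolP[l yl]]; apply/asboolP.
  by exists 0%N.
exists (k + l)%N; rewrite iter_shift_linear.
by rewrite {1}addnC !iterD xk yl !iter_shift0 scaler0 addr0.
Qed.

Definition spectral_subspace v : submod V := Submod (spectral_closed v).

Definition poly_endo p (x : V) : V := \sum_(i < size p) p`_i *: iter i f x.

Definition annihilates p := forall x, poly_endo p x = 0.

Definition is_minpoly p :=
  [/\ p \is monic, annihilates p
    & forall q, q != 0 -> annihilates q -> (size p <= size q)%N].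

(* The minimal polynomial exists when V is finite dimensional; the value 0 is
   junk. *)
Definition minpoly : {poly K} :=
  if pselect (exists p, is_minpoly p) is left h then sval (cid h) else 0.

End LinearAlgebra.

Lemma rmorph_comm (K : comPzRingType) (A : pzRingType)
  (f : {rmorphism K -> A}) c d : f c * f d = f d * f c.
Proof. by rewrite -!rmorphM mulrC. Qed.

Lemma ore_rel (A : pzRingType) (x y : A) :
  x * y - y * x = y ^+ 2 -> x * y = y * (x + y).
Proof. by move=> e; rewrite mulrDr -expr2 -e addrC subrK. Qed.

Section Algebra.
Variable K : fieldType.

Local Notation free_alg := {malg K[{fmonom bool}]}.
(* The free monoid has the letters false (for a) and true (for b). *)
Local Notation Xa := (<< fmu false >> : free_alg).
Local Notation Xb := (<< fmu true >> : free_alg).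

Definition ab_ideal : ideal2 free_alg := gen_ideal (Xa * Xb - Xb * Xa - Xb ^+ 2).

Definition ab_alg : Type := ringquot ab_ideal.
HB.instance Definition _ := GRing.PzRing.on ab_alg.

Definition ab_pi : free_alg -> ab_alg := @ringquot_pi _ ab_ideal.
HB.instance Definition _ := GRing.RMorphism.on ab_pi.

Definition ab_cst : K -> ab_alg := ab_pi \o malgC.
HB.instance Definition _ := GRing.RMorphism.on ab_cst.

Definition ab_a : ab_alg := ab_pi Xa.
Definition ab_b : ab_alg := ab_pi Xb.

Lemma ab_rel : ab_a * ab_b - ab_b * ab_a = ab_b ^+ 2.
Proof.
rewrite /ab_a /ab_b -rmorphXn -!rmorphM -!rmorphB.
by apply/ringquot_pi_eq; apply/asboolP.
Qed.

Lemma ab_alg_ind (P : ab_alg -> Prop) :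
  (forall c, P (ab_cst c)) -> P ab_a -> P ab_b ->
  (forall x y, P x -> P y -> P (x + y)) ->
  (forall x y, P x -> P y -> P (x * y)) -> forall x, P x.
Proof.
move=> Pc Pa Pb PD PM; elim/ringquot_ind=> g; rewrite -/ab_pi [g]monalgE.
rewrite rmorph_sum; apply: big_ind => [|//|k _].
  by rewrite -(rmorph0 ab_cst).
move: g@_k => c; rewrite -[k]fmK; elim: (k : seq bool) => [|x s IH].
  by rewrite -fmoneE; exact: Pc.
have -> : << c *g FMonom (x :: s) >> =
    << fmu x >> * << c *g FMonom s >> :> free_alg.
  rewrite malgM_def fgmulUU mul1r; congr << _ *g _ >>.
  by apply/eqP; rewrite fmP fmM fmU.
rewrite (rmorphM ab_pi); apply: PM IH; case: x; [exact: Pb|exact: Pa].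
Qed.

Lemma ab_pi_central c k :
  ab_cst c * ab_pi << k >> = ab_pi << k >> * ab_cst c.
Proof.
have e : c%:MP * << k >> = << k >> * c%:MP :> free_alg.
  by rewrite !malgM_def !fgmulUU mul1m mulm1 mulrC.
exact: etrans (esym (rmorphM ab_pi _ _)) (etrans (congr1 ab_pi e) (rmorphM ab_pi _ _)).
Qed.

Lemma ab_cst_central c x : ab_cst c * x = x * ab_cst c.
Proof.
elim/ab_alg_ind: x => [d|||x y cx cy|x y cx cy].
- exact: rmorph_comm.
- exact: ab_pi_central.
- exact: ab_pi_central.
- exact: GRing.commrD.
- exact: GRing.commrM.
Qed.

Lemma mul_b_right x : exists y, x * ab_b = ab_b * y.
Proof.
elim/ab_alg_ind: x => [c|||x y [x' ex] [y' ey]|x y [x' ex] [y' ey]].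
- by exists (ab_cst c); rewrite ab_cst_central.
- by exists (ab_a + ab_b); apply: ore_rel ab_rel.
- by exists ab_b.
- by exists (x' + y'); rewrite mulrDl mulrDr ex ey.
- by exists (x' * y'); rewrite -mulrA ey mulrA ex mulrA.
Qed.

Lemma mul_bX_right k x : exists y, x * ab_b ^+ k = ab_b ^+ k * y.
Proof.
elim: k x => [|k IH] x; first by exists x; rewrite mulr1 mul1r.
have [y ey] := mul_b_right x; have [z ez] := IH y.
by exists z; rewrite exprS mulrA ey -mulrA ez mulrA.
Qed.

(* The right ideal b^k A; it is two-sided by mul_bX_right. *)
Definition filt_pred k : {pred ab_alg} :=
  [pred x | `[< exists y, x = ab_b ^+ k * y >]].

Fact filt_zmod k : zmod_closed (filt_pred k).
Proof.
split=> [|_ _ /asboolP[x ->] /asboolP[y ->]]; apply/asboolP.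
  by exists 0; rewrite mulr0.
by exists (x - y); rewrite mulrBr.
Qed.

Fact filtMl k a x : x \in filt_pred k -> a * x \in filt_pred k.
Proof.
move=> /asboolP[y ->]; apply/asboolP; have [z ez] := mul_bX_right k a.
by exists (z * y); rewrite !mulrA ez.
Qed.

Fact filtMr k a x : x \in filt_pred k -> x * a \in filt_pred k.
Proof.
by move=> /asboolP[y ->]; apply/asboolP; exists (y * a); rewrite mulrA.
Qed.

Definition filt k : ideal2 ab_alg := Ideal2 (@filt_zmod k) (@filtMl k) (@filtMr k).

Definition cauchy_pred : {pred nat -> ab_alg} :=
  [pred u : nat -> ab_alg | `[< forall k, exists N, forall m n,
     (N <= m)%N -> (N <= n)%N -> u m - u n \in filt k >]].

Fact cauchy_subring : GRing.subring_closed cauchy_pred.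
Proof.
split=> [|u v /asboolP cu /asboolP cv|u v /asboolP cu /asboolP cv];
  apply/asboolP=> k.
- by exists 0%N => m n _ _; rewrite subrr rpred0.
- have [N hN] := cu k; have [N' hN'] := cv k.
  exists (maxn N N') => m n; rewrite !geq_max => /andP[m1 m2] /andP[n1 n2].
  have -> : (u - v) m - (u - v) n = (u m - u n) - (v m - v n).
    rewrite -[LHS]/((u m - v m) - (u n - v n)) !opprB.
    by rewrite addrACA [RHS]addrACA [- v m + _]addrC.
  by rewrite rpredB ?hN ?hN'.
- have [N hN] := cu k; have [N' hN'] := cv k.
  exists (maxn N N') => m n; rewrite !geq_max => /andP[m1 m2] /andP[n1 n2].
  have -> : (u * v) m - (u * v) n = (u m - u n) * v m + u n * (v m - v n).
    by rewrite mulrBl mulrBr addrA subrK.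
  exact: (rpredD (ideal2Mr _ (hN _ _ m1 n1)) (ideal2Ml _ (hN' _ _ m2 n2))).
Qed.

HB.instance Definition _ :=
  GRing.isSubringClosed.Build (nat -> ab_alg) cauchy_pred cauchy_subring.

Definition cauchy_seq : Type := {u : nat -> ab_alg | u \in cauchy_pred}.
Definition CauchySeq (u : nat -> ab_alg) (cu : u \in cauchy_pred) : cauchy_seq :=
  exist _ u cu.
HB.instance Definition _ := SubType.on cauchy_seq.
HB.instance Definition _ := Choice.on cauchy_seq.
HB.instance Definition _ := GRing.SubChoice_isSubPzRing.Build
  (nat -> ab_alg) cauchy_pred cauchy_seq cauchy_subring.

Definition null_pred : {pred cauchy_seq} :=
  [pred u : cauchy_seq | `[< forall k, exists N, forall n,
     (N <= n)%N -> val u n \in filt k >]].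

Fact null_zmod : zmod_closed null_pred.
Proof.
split=> [|u v /asboolP cu /asboolP cv]; apply/asboolP=> k.
  by exists 0%N => n _; apply: rpred0.
have [N hN] := cu k; have [N' hN'] := cv k.
exists (maxn N N') => n; rewrite !geq_max => /andP[n1 n2].
by apply: rpredB; [exact: hN|exact: hN'].
Qed.

Fact nullMl a x : x \in null_pred -> a * x \in null_pred.
Proof.
move=> /asboolP cx; apply/asboolP=> k; have [N hN] := cx k.
by exists N => n /hN; apply: ideal2Ml.
Qed.

Fact nullMr a x : x \in null_pred -> x * a \in null_pred.
Proof.
move=> /asboolP cx; apply/asboolP=> k; have [N hN] := cx k.
by exists N => n /hN; apply: ideal2Mr.
Qed.

Definition null_ideal : ideal2 cauchy_seq := Ideal2 null_zmod nullMl nullMr.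

(* The completion for the filtration (b^k A)_k: Cauchy sequences modulo null
   sequences. *)
Definition ab_compl : Type := ringquot null_ideal.
HB.instance Definition _ := GRing.PzRing.on ab_compl.

Definition cauchy_lim : cauchy_seq -> ab_compl := ringquot_pi null_ideal.
HB.instance Definition _ := GRing.RMorphism.on cauchy_lim.

Fact cauchy_cst (x : ab_alg) : (fun=> x) \in cauchy_pred.
Proof. by apply/asboolP=> k; exists 0%N => m n _ _; rewrite subrr rpred0. Qed.

Definition to_compl (x : ab_alg) : ab_compl := cauchy_lim (CauchySeq (cauchy_cst x)).

Fact to_compl_zmod : zmod_morphism to_compl.
Proof.
by move=> x y; rewrite /to_compl -raddfB; congr cauchy_lim; apply: val_inj.
Qed.
HB.instance Definition _ :=
  GRing.isZmodMorphism.Build ab_alg ab_compl to_compl to_compl_zmod.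

Fact to_compl_monoid : monoid_morphism to_compl.
Proof.
split=> [|x y]; rewrite /to_compl -?rmorphM -?(rmorph1 cauchy_lim);
  by congr cauchy_lim; apply: val_inj.
Qed.
HB.instance Definition _ :=
  GRing.isMonoidMorphism.Build ab_alg ab_compl to_compl to_compl_monoid.

Definition cA : K -> ab_compl := to_compl \o ab_cst.
HB.instance Definition _ := GRing.RMorphism.on cA.
Definition aA : ab_compl := to_compl ab_a.
Definition bA : ab_compl := to_compl ab_b.

Lemma abA_rel : aA * bA - bA * aA = bA ^+ 2.
Proof. by rewrite -[bA ^+ 2](rmorphXn to_compl) -ab_rel rmorphB !rmorphM. Qed.

Lemma cA_central c t : cA c * t = t * cA c.
Proof.
elim/ringquot_ind: t => u; rewrite -/(cauchy_lim u) /cA /to_compl /=.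
rewrite -!rmorphM; congr cauchy_lim; apply: val_inj.
by apply/funext=> n; apply: ab_cst_central.
Qed.

Definition pseries_sum (c : nat -> K) (n : nat) : ab_alg :=
  \sum_(i < n) ab_cst (c i) * ab_b ^+ i.

Fact pseries_cauchy c : pseries_sum c \in cauchy_pred.
Proof.
apply/asboolP=> k; exists k => m n.
have tail p q : (k <= p)%N -> (p <= q)%N ->
    pseries_sum c q - pseries_sum c p \in filt k.
  move=> kp pq; rewrite /pseries_sum -!(big_mkord xpredT (fun i => ab_cst (c i) * ab_b ^+ i)).
  rewrite (big_cat_nat (leq0n p) pq)  addrAC subrr add0r.
  rewrite big_nat; apply: rpred_sum => i /andP[pi _]; apply: ideal2Ml.
  by apply/asboolP; exists (ab_b ^+ (i - k)); rewrite -exprD subnKC // (leq_trans kp).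
move=> km kn; case: (leqP n m) => [|/ltnW] nm; first exact: tail.
by rewrite -opprB rpredN tail.
Qed.

(* sum_i (c i) b^i, as the limit of its partial sums *)
Definition pseries (c : nat -> K) : ab_compl :=
  cauchy_lim (CauchySeq (pseries_cauchy c)).

(* Membership in the subalgebra K[[b]] of the completion. *)
Definition is_pseries (t : ab_compl) := exists c, t = pseries c.

End Algebra.

Section Modules.
Variable K : fieldType.
Local Notation At := (ab_compl K).

(* Freeness over K[[b]], a subset of the completion: the coefficients of the
   linear combinations are the elements satisfying is_pseries. *)
Definition pseries_basis (E : lmodType At) n (e : 'I_n -> E) :=
  (forall x, exists2 s : 'I_n -> At,
     forall i, is_pseries (s i) & x = \sum_i s i *: e i) /\
  (forall s : 'I_n -> At, (forall i, is_pseries (s i)) ->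
     \sum_i s i *: e i = 0 -> forall i, s i = 0).

Definition has_rank (E : lmodType At) n :=
  exists e : 'I_n -> E, pseries_basis e.

Definition is_ab_module (E : lmodType At) := exists n, has_rank E n.

Section Fiber.
Variable E : lmodType At.

Definition vspace_of : lmodType K := res_scalars (@cA K) E.

Definition act (t : At) : {linear vspace_of -> vspace_of} :=
  res_act E (fun c => cA_central c t).

Definition bE_pred : {pred vspace_of} :=
  [pred x | `[< exists y, x = act (bA K) y >]].

Fact bE_closed : GRing.submod_closed bE_pred.
Proof.
split=> [|c _ _ /asboolP[x ->] /asboolP[y ->]]; apply/asboolP.
  by exists 0; rewrite linear0.
by exists (c *: x + y); rewrite linearP.
Qed.

Definition bE : submod vspace_of := Submod bE_closed.

Fact bE_stable x : x \in bE -> act (aA K) x \in bE.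
Proof.
move=> /asboolP[y ->]; apply/asboolP; exists (act (aA K + bA K) y).
by rewrite /= /res_act_fun !scalerA (ore_rel (abA_rel K)).
Qed.

(* E/bE is only taken as a K-vector space, with the endomorphism fiber_a induced
   by a. *)
Definition fiber : lmodType K := quot_lmod bE.

Definition fiber_a : {linear fiber -> fiber} := quot_endo bE_stable.

End Fiber.

Definition normal (E : lmodType At) (G : submod E) :=
  forall x : E, (x \in G /\ exists y, x = bA K *: y) <->
                (exists2 y, y \in G & x = bA K *: y).

(* G/bG and F_v are isomorphic: the isomorphism is K-linear and commutes with
   the actions of a. Here fiber (sub_lmod G) is G/bG, the quotient of the module
   G itself, and not its image in E/bE. *)
Definition fiber_iso_spectral (E : lmodType At) (G : submod E) (v : K) :=
  exists phi : {linear fiber (sub_lmod G) ->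
                       sub_lmod (spectral_subspace (fiber_a E) v)},
    bijective phi /\
    forall x, val (phi (fiber_a (sub_lmod G) x)) = fiber_a E (val (phi x)).

Definition has_dim (V : lmodType K) n := inhabited (Vector.axiom n V).

(* E is the internal direct sum of the G v for v in s, where s has no repeated
   element. *)
Definition is_direct_sum (E : lmodType At) (s : seq K) (G : K -> submod E) :=
  (forall x : E, exists2 g : K -> E,
     forall v, v \in s -> g v \in G v & x = \sum_(v <- s) g v) /\
  (forall g : K -> E, (forall v, v \in s -> g v \in G v) ->
     \sum_(v <- s) g v = 0 -> forall v, v \in s -> g v = 0).

End Modules.

(* Main.v *)
Require Import Defs.
From HB Require Import structures.
From mathcomp Require Import all_boot all_order all_algebra.
From mathcomp Require Import boolp reals complex monalg.

Set Implicit Arguments.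
Unset Strict Implicit.
Unset Printing Implicit Defensive.

Import GRing.Theory.
Local Open Scope ring_scope.

(* Since a b = b (a + b), the operator a induces an endomorphism of each E/b^kE.
   G_v consists of the x in E that are killed, modulo each b^k E, by some power
   of a - v. It is stable under the completed algebra, because every element of
   the latter is congruent to a polynomial in a and b modulo b^k. As mu(a) maps
   b^kE to b^(k+1)E for the minimal polynomial mu of a on E/bE, the power mu^k
   annihilates E/b^kE, and the Chinese remainder theorem splits E/b^kE into its
   generalized eigenspaces; uniqueness of this splitting makes it compatible
   with k, and completeness of E gives the decomposition of E. Normality of G_v
   follows from uniqueness of the decomposition and injectivity of b. A basis of
   G_v/bG_v then lifts to a C[[b]]-basis of G_v by successive approximation. *)

(** * Polynomials in an endomorphism *)

Section IterLinear.
Variables (K : fieldType) (V : lmodType K) (f : {linear V -> V}).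

Fact iter_is_linear k : linear (iter k f).
Proof. by elim: k => // k IH c x y; rewrite !iterS IH linearP. Qed.
HB.instance Definition _ k :=
  GRing.isLinear.Build K V V *:%R (iter k f) (iter_is_linear k).

End IterLinear.

Section PolyEndo.
Variables (K : fieldType) (V : lmodType K) (f : {linear V -> V}).
Implicit Types (v c : K) (p q : {poly K}) (x y : V).

(** Coefficients beyond the size vanish, so polynomials of different sizes can be evaluated over one
    common range of indices. *)
Lemma poly_endo_wide n p x : (size p <= n)%N ->
  poly_endo f p x = \sum_(i < n) p`_i *: iter i f x.
Proof.
move=> pn; rewrite /poly_endo (big_ord_widen _ (fun i => p`_i *: iter i f x) pn).
rewrite big_mkcond; apply: eq_bigr => i _.
by case: ltnP => // /(nth_default 0) ->; rewrite scale0r.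
Qed.

Lemma poly_endoP c p q x :
  poly_endo f (c *: p + q) x = c *: poly_endo f p x + poly_endo f q x.
Proof.
pose n := maxn (size p) (size q).
have le1 : (size (c *: p + q)%R <= n)%N.
  rewrite (leq_trans (size_polyD _ _)) // geq_max leq_maxr andbT.
  exact: leq_trans (size_scale_leq _ _) (leq_maxl _ _).
rewrite (poly_endo_wide x le1) (poly_endo_wide x (leq_maxl _ _ : (_ <= n)%N)).
rewrite (poly_endo_wide x (leq_maxr _ _ : (_ <= n)%N)).
rewrite scaler_sumr -big_split; apply: eq_bigr => i _.
by rewrite coefD coefZ scalerDl scalerA.
Qed.

Lemma poly_endo0 x : poly_endo f 0 x = 0.
Proof. by rewrite /poly_endo size_poly0 big_ord0. Qed.

Lemma poly_endoD p q x : poly_endo f (p + q) x = poly_endo f p x + poly_endo f q x.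
Proof. by rewrite -[p]scale1r poly_endoP !scale1r. Qed.

Lemma poly_endoC c x : poly_endo f c%:P x = c *: x.
Proof. by rewrite (poly_endo_wide x (size_polyC_leq1 c)) big_ord1 coefC. Qed.

Lemma poly_endo_is_linear p : linear (poly_endo f p).
Proof.
move=> c x y; rewrite /poly_endo scaler_sumr -big_split; apply: eq_bigr => i _.
by rewrite linearP scalerDr !scalerA mulrC.
Qed.
HB.instance Definition _ p :=
  GRing.isLinear.Build K V V *:%R (poly_endo f p) (poly_endo_is_linear p).

Lemma poly_endoMX p x : poly_endo f (p * 'X) x = poly_endo f p (f x).
Proof.
have le : (size (p * 'X)%R <= (size p).+1)%N.
  by rewrite (leq_trans (size_polyMleq _ _)) // size_polyX addn2.
rewrite (poly_endo_wide x le) big_ord_recl coefMX scale0r add0r /poly_endo.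
by apply: eq_bigr => i _; rewrite coefMX /= -iterS iterSr.
Qed.

Lemma poly_endoM p q x : poly_endo f (p * q) x = poly_endo f q (poly_endo f p x).
Proof.
rewrite mulrC; elim/poly_ind: q x => [|q c IH] x; first by rewrite mul0r !poly_endo0.
rewrite mulrDl -mulrA ['X * p]mulrC mulrA mul_polyC [in RHS]poly_endoD.
rewrite addrC poly_endoP addrC poly_endoC !poly_endoMX IH; congr (poly_endo f q _ + _).
(* What remains is that p(f) commutes with f. *)
elim/poly_ind: p {IH} x => [|p d IH] x; first by rewrite !poly_endo0 linear0.
by rewrite !poly_endoD !poly_endoMX IH !poly_endoC linearD linearZ.
Qed.

Lemma poly_endo_XsubC v n x :
  poly_endo f (('X - v%:P) ^+ n) x = iter n (shift_endo f v) x.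
Proof.
elim: n => [|n IH]; first by rewrite expr0 poly_endoC scale1r.
rewrite exprSr poly_endoM IH iterS -polyCN poly_endoD poly_endoC.
by rewrite -['X]mul1r poly_endoMX poly_endoC scale1r scaleNr.
Qed.

Lemma poly_endo_eigen p v x : f x = v *: x -> poly_endo f p x = p.[v] *: x.
Proof.
move=> e; elim/poly_ind: p => [|p c IH]; first by rewrite poly_endo0 horner0 scale0r.
rewrite poly_endoD poly_endoMX poly_endoC e linearZ /= IH hornerMXaddC scalerDl.
by rewrite scalerA mulrC.
Qed.

(** * Torsion modulo a stable subspace *)

Section Modulo.
Variables (W : submod V) (fW : forall x, x \in W -> f x \in W).

Lemma poly_endo_stable p x : x \in W -> poly_endo f p x \in W.
Proof.
move=> xW; apply: rpred_sum => i _; apply: rpredZ.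
by elim: (i : nat) => //= k; apply: fW.
Qed.

Lemma shift_stable v n x : x \in W -> iter n (shift_endo f v) x \in W.
Proof. by move=> xW; rewrite -poly_endo_XsubC poly_endo_stable. Qed.

(** A Bezout relation u p + v q = 1 writes x as a sum of two terms, one through p(f) x and one
    through q(f) x. *)
Lemma coprime_mod p q x : coprimep p q ->
  poly_endo f p x \in W -> poly_endo f q x \in W -> x \in W.
Proof.
move=> /Bezout_eq1_coprimepP[[u v] /= e] px qx.
rewrite -[x]scale1r -poly_endoC -[1%:P]e poly_endoD [u * p]mulrC [v * q]mulrC.
by rewrite !poly_endoM; apply: rpredD; apply: poly_endo_stable.
Qed.

Lemma coprime_XsubC_prod v (s : seq K) (n : nat) (N : K -> nat) : v \notin s ->
  coprimep (('X - v%:P) ^+ n) (\prod_(w <- s) ('X - w%:P) ^+ N w).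
Proof.
elim: s => [|w s IH]; first by rewrite big_nil coprimep1.
rewrite inE negb_or => /andP[vw vs]; rewrite big_cons coprimepMr IH // andbT.
by rewrite coprimep_expl // coprimep_expr // coprimep_XsubC2 // subr_eq0 eq_sym.
Qed.

Lemma poly_endo_dvd p q x : p %| q -> poly_endo f p x \in W -> poly_endo f q x \in W.
Proof. by move=> /dvdpP[r ->] px; rewrite mulrC poly_endoM poly_endo_stable. Qed.

(** Induction on s. If u p + w q = 1 for the first factor p and the product q of the others, then (w
    q)(f) x is killed by p(f) modulo W and serves as the component at v, while (u p)(f) x is killed
    by q(f) and is split by induction. *)
Lemma split_mod (s : seq K) (N : K -> nat) x : uniq s ->
  poly_endo f (\prod_(v <- s) ('X - v%:P) ^+ N v) x \in W ->
  exists2 g : K -> V, forall v, v \in s -> iter (N v) (shift_endo f v) (g v) \in W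
    & x - \sum_(v <- s) g v \in W.
Proof.
elim: s x => [|v s IH] x /=.
  by rewrite big_nil poly_endoC scale1r => _ xW; exists (fun=> 0); rewrite ?big_nil ?subr0.
move=> /andP[vs us]; rewrite big_cons; set p := _ ^+ _; set q := (X in p * X) => pq.
have /Bezout_eq1_coprimepP[[u w] /= e] : coprimep p q by apply: coprime_XsubC_prod.
have [||g gW xg] := IH (poly_endo f (u * p) x) => //.
  by rewrite -poly_endoM -/q -mulrA mulrC poly_endoM poly_endo_stable.
exists (fun z => if z == v then poly_endo f (w * q) x else g z) => [z|].
  rewrite inE; case: eqVneq => [->|_ /gW//] _.
  rewrite -poly_endo_XsubC -poly_endoM -mulrA mulrC poly_endoM poly_endo_stable //.
  by rewrite mulrC.
rewrite big_cons eqxx (eq_big_seq g) => [|z zs].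
  rewrite -{1}[x]scale1r -poly_endoC -[1%:P]e poly_endoD.
  by rewrite addrKA.
by case: eqVneq => // zv; rewrite -zv zs in vs.
Qed.

(** Modulo W, g v is killed by a power of f - v. Being the total minus the other terms, it is also
    killed by a product of powers of f - w with w different from v, and these polynomials are
    coprime. *)
Lemma direct_mod (s : seq K) (g : K -> V) : uniq s ->
  (forall v, v \in s -> exists n, iter n (shift_endo f v) (g v) \in W) ->
  \sum_(v <- s) g v \in W -> forall v, v \in s -> g v \in W.
Proof.
move=> us tg sW v vs.
have /choice[N hN] : forall w, exists n, w \in s -> iter n (shift_endo f w) (g w) \in W.
  by move=> w; case: (boolP (w \in s)) => [/tg[n h]|_]; [exists n|exists 0%N].
pose q := \prod_(w <- rem v s) ('X - w%:P) ^+ N w.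
apply: (@coprime_mod (('X - v%:P) ^+ N v) q).
- by apply: coprime_XsubC_prod; rewrite mem_rem_uniq // inE eqxx.
- by rewrite poly_endo_XsubC hN.
have -> : g v = \sum_(w <- s) g w - \sum_(w <- rem v s) g w.
  by rewrite (big_rem v vs) /= addrK.
rewrite linearB; apply: rpredB; first exact: poly_endo_stable.
rewrite linear_sum big_seq; apply: rpred_sum => w ws.
apply: (@poly_endo_dvd (('X - w%:P) ^+ N w)).
  by rewrite /q (big_rem w ws) dvdp_mulIl.
by rewrite poly_endo_XsubC hN // (mem_rem ws).
Qed.

(** The preimage in V of the generalized eigenspace of V/W at v, described without forming the
    quotient. *)
Definition torsion_pred v : {pred V} :=
  [pred x | `[< exists n, iter n (shift_endo f v) x \in W >]].

Fact torsion_closed v : GRing.submod_closed (torsion_pred v).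
Proof.
split=> [|c x y /asboolP[k xk] /asboolP[l yl]]; apply/asboolP.
  by exists 0%N; apply: rpred0.
exists (k + l)%N; rewrite iter_shift_linear rpredD ?rpredZ //.
  by rewrite addnC iterD shift_stable.
by rewrite iterD shift_stable.
Qed.

Definition torsion v : submod V := Submod (torsion_closed v).

Lemma torsionP v x :
  reflect (exists n, iter n (shift_endo f v) x \in W) (x \in torsion v).
Proof. exact: asboolP. Qed.

Lemma sub_torsion v x : x \in W -> x \in torsion v.
Proof. by move=> xW; apply/torsionP; exists 0%N. Qed.

Lemma torsion_shift v x : shift_endo f v x \in torsion v -> x \in torsion v.
Proof. by move=> /torsionP[n h]; apply/torsionP; exists n.+1; rewrite iterSr. Qed.

Lemma torsion_stable v x : x \in torsion v -> f x \in torsion v.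
Proof.
move=> /torsionP[n h]; apply/torsionP; exists n.
rewrite -poly_endo_XsubC -[f x]scale1r -poly_endoC -poly_endoMX -poly_endoM mulrC.
by rewrite poly_endoM; apply: poly_endo_stable; rewrite poly_endo_XsubC.
Qed.

End Modulo.
End PolyEndo.

(** * Splitting off generalized eigenspaces *)

Section Splitting.
Variables (K : fieldType) (V : lmodType K) (a b : {linear V -> V}).
Hypothesis abE : forall x, a (b x) = b (a x + b x).

Definition imb_pred k : {pred V} := [pred x | `[< exists y, x = iter k b y >]].

Fact imb_closed k : GRing.submod_closed (imb_pred k).
Proof.
split=> [|c _ _ /asboolP[x ->] /asboolP[y ->]]; apply/asboolP.
  by exists 0; rewrite linear0.
by exists (c *: x + y); rewrite linearP.
Qed.

Definition imb k : submod V := Submod (imb_closed k).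

Lemma imbP k x : reflect (exists y, x = iter k b y) (x \in imb k).
Proof. exact: asboolP. Qed.

Lemma iter_imb k x : iter k b x \in imb k.
Proof. by apply/imbP; exists x. Qed.

Lemma imb_le k l x : (l <= k)%N -> x \in imb k -> x \in imb l.
Proof.
move=> lk /imbP[y ->]; apply/imbP; exists (iter (k - l) b y).
by rewrite -iterD subnKC.
Qed.

(** Each of the k factors b that a crosses contributes one b^(k+1), by [abE]. *)
Lemma a_iterb k x : a (iter k b x) = iter k b (a x) + k%:R *: iter k.+1 b x.
Proof.
elim: k => [|k IH]; first by rewrite scale0r addr0.
rewrite [iter k.+1 b x]iterS abE IH -addrA -natr1 scalerDl scale1r.
by rewrite !linearD linearZ.
Qed.

Lemma imb_a k x : x \in imb k -> a x \in imb k.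
Proof.
move=> /imbP[y ->]; rewrite a_iterb rpredD ?iter_imb // rpredZ //.
by apply: (@imb_le k.+1) => //; apply: iter_imb.
Qed.

Lemma iterb_imb k l x : x \in imb l -> iter k b x \in imb (k + l).
Proof. by move=> /imbP[y ->]; rewrite -iterD iter_imb. Qed.

Lemma shift_iterb v k x :
  shift_endo a v (iter k b x) = iter k b (shift_endo a v x) + k%:R *: iter k.+1 b x.
Proof. by rewrite /shift_endo a_iterb addrAC linearB /= [iter k b (v *: x)]linearZ. Qed.

Local Notation tors k v := (torsion (@imb_a k) v).

(* Descending induction on j, starting from b^k V: commuting a - v with b^j
   produces the extra term j b^(j+1). *)
Lemma iterb_torsion v k j x : x \in tors k v -> iter j b x \in tors k v.
Proof.
suff: forall m j x, (k <= j + m)%N -> x \in tors k v -> iter j b x \in tors k v.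
  by move=> /(_ k j x (leq_addl _ _)).
elim=> [|m IHm] {}j {}x kj.
  by move=> _; apply: sub_torsion; apply: (@imb_le j); [rewrite addn0 in kj|exact: iter_imb].
move=> /torsionP[n]; elim: n x => [|n IHn] x hx.
  by apply: sub_torsion; apply: (@imb_le (j + k)); rewrite ?leq_addl ?iterb_imb.
apply: torsion_shift; rewrite shift_iterb rpredD ?rpredZ //.
  by apply: IHn; rewrite -iterSr.
by apply: IHm; rewrite ?addSnnS //; apply/torsionP; exists n.+1.
Qed.

Definition spec_pred v : {pred V} := [pred x | `[< forall k, x \in tors k v >]].

Fact spec_closed v : GRing.submod_closed (spec_pred v).
Proof.
split=> [|c x y /asboolP hx /asboolP hy]; apply/asboolP=> k; first exact: rpred0.
by apply: rpredD; [apply: rpredZ; apply: hx|apply: hy].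
Qed.

Definition spec v : submod V := Submod (spec_closed v).

Lemma specP v x : reflect (forall k, x \in tors k v) (x \in spec v).
Proof. exact: asboolP. Qed.

Lemma spec_a v x : x \in spec v -> a x \in spec v.
Proof. by move=> /specP hx; apply/specP=> k; apply: torsion_stable. Qed.

Lemma spec_iterb v k x : x \in spec v -> iter k b x \in spec v.
Proof. by move=> /specP hx; apply/specP=> l; apply: iterb_torsion. Qed.

(** By [a_iterb], a commutes with b^k up to b^(k+1)V, which is stable under a; this passes to
    polynomials in a. It carries what is known of p(a) on V/bV to the higher quotients. *)
Lemma poly_endo_iterb p k x :
  poly_endo a p (iter k b x) - iter k b (poly_endo a p x) \in imb k.+1.
Proof.
elim/poly_ind: p x => [|p c IH] x.
  by rewrite !poly_endo0 linear0 subr0 rpred0.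
rewrite !poly_endoD !poly_endoMX !poly_endoC a_iterb.
rewrite [poly_endo a p (_ + _)]linearD [iter k b (_ + _)]linearD /=.
rewrite [poly_endo a p (_ *: _)]linearZ [iter k b (_ *: _)]linearZ /=.
rewrite opprD addrACA subrr addr0 addrAC.
apply: (rpredD (IH _)); apply: (rpredZ (k%:R)).
apply: (poly_endo_stable (@imb_a k.+1)); exact: (iter_imb k.+1 x).
Qed.

Hypothesis b_inj : injective b.
Hypothesis b_sep : forall x, (forall k, x \in imb k) -> x = 0.
(** Unrolled, X k is the series y k + b y (k+1) + b^2 y (k+2) + ...; all its tails are provided
    together, each tied to the next. *)
Hypothesis b_compl : forall y : nat -> V,
  exists X : nat -> V, forall k, X k = y k + b (X k.+1).
Variables (s : seq K) (N : K -> nat).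
Hypothesis s_uniq : uniq s.
Let P := \prod_(v <- s) ('X - v%:P) ^+ N v.
Hypothesis P_im : forall x, poly_endo a P x \in imb 1.

(** Each factor P(a) raises the order in b by one: up to b^(k+1)V it sends b^k y to b^k P(a) y, and
    P(a) y lies in bV. *)
Lemma poly_exp_imb k x : poly_endo a (P ^+ k) x \in imb k.
Proof.
elim: k => [|k IH]; first by apply/imbP; exists (poly_endo a 1 x).
have /imbP[y ey] := IH; rewrite exprSr poly_endoM ey.
rewrite -[X in X \in _](subrK (iter k b (poly_endo a P y))) rpredD ?poly_endo_iterb //.
by rewrite -addn1 iterb_imb.
Qed.

Lemma split_imb k x : exists2 g : K -> V,
  forall v, v \in s -> g v \in tors k v & x - \sum_(v <- s) g v \in imb k.
Proof.
(* The exponents [N v * k] are those of P^k, which sends V into b^k V. *)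
have [|g gs xg] := @split_mod _ _ a (imb k) (@imb_a k) s (fun v => N v * k)%N x s_uniq.
  rewrite (eq_bigr (fun v => (('X - v%:P) ^+ N v) ^+ k)) => [|v _]; last exact: exprM.
  by rewrite prodrXl poly_exp_imb.
by exists g => // v /gs h; apply/torsionP; exists (N v * k)%N.
Qed.

Lemma direct_imb k (g : K -> V) : (forall v, v \in s -> g v \in tors k v) ->
  \sum_(v <- s) g v \in imb k -> forall v, v \in s -> g v \in imb k.
Proof. by move=> hg; apply: (direct_mod (@imb_a k)) => // v /hg/torsionP. Qed.

Lemma torsion_le k l v x : (l <= k)%N -> x \in tors k v -> x \in tors l v.
Proof.
by move=> lk /torsionP[n h]; apply/torsionP; exists n; apply: imb_le h.
Qed.

Theorem spec_split x : exists2 g : K -> V,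
  forall v, v \in s -> g v \in spec v & x = \sum_(v <- s) g v.
Proof.
have /choice[g hg] : forall k, exists g : K -> V,
    (forall v, v \in s -> g v \in tors k v) /\ x - \sum_(v <- s) g v \in imb k.
  by move=> k; have [g h1 h2] := split_imb k x; exists g.
(* Components at levels k and k+1 both split x modulo b^k V, so directness makes them congruent. The
   default y = 0 outside s serves the later use of [choice]. *)
have step k v : exists y, v \in s -> g k.+1 v = g k v + iter k b y.
  case: (boolP (v \in s)) => [vs|_]; last by exists 0.
  suff /imbP[y ey] : g k.+1 v - g k v \in imb k by exists y; rewrite -ey addrC subrK.
  apply: (@direct_imb k (fun v => g k.+1 v - g k v)) vs => [w ws|].
    by rewrite rpredB ?(hg k).1 // (torsion_le (leqnSn k)) ?(hg k.+1).1.
  have -> : \sum_(w <- s) (g k.+1 w - g k w)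
      = (x - \sum_(w <- s) g k w) - (x - \sum_(w <- s) g k.+1 w).
    by rewrite opprB addrC subrKA sumrB.
  by rewrite rpredB ?(hg k).2 // (imb_le (leqnSn k)) ?(hg k.+1).2.
(* X k gathers all corrections from level k on, divided by b^k. Hence g k v + b^k X k is independent
   of k; its value at k = 0 is the component sought. *)
have /choice[X hX] : forall v, exists X : nat -> V, forall k, v \in s ->
    g k.+1 v + iter k.+1 b (X k.+1) = g k v + iter k b (X k).
  move=> v; have /choice[y hy] := step^~ v; have [X hX] := b_compl y.
  by exists X => k /hy ->; rewrite [X k]hX linearD /= -iterSr addrA.
pose G v := g 0%N v + X v 0%N.
have GE k v : v \in s -> G v = g k v + iter k b (X v k).
  by move=> vs; elim: k => // k ->; rewrite hX.
exists G => [v vs|].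
  apply/specP => k; rewrite (GE k) // rpredD ?(hg k).1 //.
  by apply: sub_torsion; apply: iter_imb.
apply/eqP; rewrite -subr_eq0; apply/eqP/b_sep => k.
rewrite (eq_big_seq _ (GE k)) big_split opprD addrA rpredB ?(hg k).2 //.
by apply: rpred_sum => v _; apply: iter_imb.
Qed.

Theorem spec_direct (g : K -> V) : (forall v, v \in s -> g v \in spec v) ->
  \sum_(v <- s) g v = 0 -> forall v, v \in s -> g v = 0.
Proof.
move=> hg sg v vs; apply: b_sep => k; apply: direct_imb vs => [w /hg/specP//|].
by rewrite sg rpred0.
Qed.

Lemma sum_delta (h : K -> V) v : v \in s ->
  \sum_(w <- s) (if w == v then h w else 0) = h v.
Proof. by move=> vs; rewrite -big_mkcond -big_filter filter_pred1_uniq // big_seq1. Qed.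

(** Applying b to the splitting of y splits b y, which has only a component at v. So b kills every
    other component of y, and injectivity of b makes that component zero. *)
Lemma spec_normal v y : v \in s -> b y \in spec v -> y \in spec v.
Proof.
move=> vs hy; have [g hg ey] := spec_split y.
suff h w : w \in s -> w != v -> g w = 0.
  rewrite ey big_seq rpred_sum // => w ws; have [->|/(h w ws)->] := eqVneq w v.
    exact: hg.
  exact: rpred0.
move=> ws wv; apply: b_inj; rewrite linear0.
(* The difference of the two splittings of b y. *)
pose c u := b (g u) - (if u == v then b y else 0).
suff: c w = 0 by rewrite /c (negPf wv) subr0.
apply: spec_direct ws => [u us|].
  rewrite rpredB ?(spec_iterb 1) ?hg //; case: eqP => [->//|_]; exact: rpred0.
by rewrite sumrB (sum_delta (fun=> b y)) // ey linear_sum subrr.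
Qed.

(** The component of x at v is the lift: modulo bV, x is also split by the family that is x at v and
    0 elsewhere. This gives surjectivity onto F_v. *)
Lemma spec_lift v x : v \in s -> x \in tors 1 v ->
  exists2 y, y \in spec v & x - y \in imb 1.
Proof.
move=> vs hx; have [g hg ex] := spec_split x; exists (g v); first exact: hg.
pose c u := (if u == v then x else 0) - g u.
suff: c v \in imb 1 by rewrite /c eqxx.
apply: direct_imb (vs) => [u us|].
  have /specP/(_ 1%N) gu := hg u us; rewrite /c rpredB //.
  by case: eqP => [->//|_]; exact: rpred0.
by rewrite /c sumrB (sum_delta (fun=> x)) // -ex subrr rpred0.
Qed.

End Splitting.

(** * Minimal polynomials and finite dimension *)

Section MinPoly.
Variables (K : fieldType) (V : lmodType K) (f : {linear V -> V}).

(** Write p = q (X - v)^m with m = [mup v p] and q prime to X - v. Modulo W, the vector (f - v)^m x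
    is killed both by q(f) and by a power of f - v. This is the source of the exponent d(v). *)
Lemma iter_mup_mod (W : submod V) (fW : forall x, x \in W -> f x \in W) v p x :
  p != 0 -> poly_endo f p x \in W -> x \in torsion fW v ->
  iter (mup v p) (shift_endo f v) x \in W.
Proof.
move=> p0 px /torsionP[n xn]; set y := iter _ _ x.
have /dvdpP[q pq] : ('X - v%:P) ^+ mup v p %| p by rewrite -mup_geq.
apply: (@coprime_mod _ _ f W fW (('X - v%:P) ^+ n) q).
- rewrite coprimep_expl // coprimep_sym coprimep_XsubC; apply/negP => /factor_theorem[r qr].
  have: (mup v p < (mup v p).+1)%N by [].
  by rewrite ltnNge mup_geq // {2}pq qr -mulrA -exprS dvdp_mulIr.
- by rewrite poly_endo_XsubC /y -iterD addnC iterD shift_stable.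
by rewrite /y -poly_endo_XsubC -poly_endoM mulrC -pq.
Qed.

Lemma minpolyP : (exists2 p, p != 0 & annihilates f p) -> is_minpoly f (minpoly f).
Proof.
move=> [p p0 fp]; suff ex : exists p, is_minpoly f p.
  by rewrite /minpoly; case: pselect => // h; exact: (svalP (cid h)).
have exn : exists n, `[< exists2 q, q != 0 & annihilates f q /\ size q = n >].
  by exists (size p); apply/asboolP; exists p.
case: (ex_minnP exn) => n /asboolP[q q0 [fq sq]] nmin.
exists ((lead_coef q)^-1 *: q); split.
- by rewrite monicE lead_coefZ mulVf ?lead_coef_eq0.
- by move=> x; rewrite -[_ *: q]addr0 poly_endoP fq poly_endo0 scaler0 addr0.
move=> r r0 fr; rewrite size_scale ?invr_eq0 ?lead_coef_eq0 // sq.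
by apply: nmin; apply/asboolP; exists r.
Qed.

(** On an eigenvector p(f) acts as p(v). Conversely, if p = q (X - v), minimality gives x with q(f)
    x nonzero, and that vector is an eigenvector. *)
Lemma eigenvalue_root p v : is_minpoly f p -> is_eigenvalue f v <-> root p v.
Proof.
move=> [pm fp pmin]; split=> [[x x0 fx]|/factor_theorem[q pq]].
  have := fp x; rewrite (poly_endo_eigen _ fx) => /eqP.
  by rewrite scaler_eq0 (negPf x0) orbF.
have q0 : q != 0.
  by apply/eqP => q0; move: (monic_neq0 pm); rewrite pq q0 mul0r eqxx.
have [x /eqP qx] : exists x, poly_endo f q x <> 0.
  apply: contrapT => h; have /(pmin _ q0) : annihilates f q.
    by move=> x; apply: contrapT => hx; apply: h; exists x.
  by rewrite pq size_Mmonic ?monicXsubC // size_XsubC addn2 ltnn.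
exists (poly_endo f q x) => //; apply/eqP; rewrite -subr_eq0.
rewrite -[_ - _]/(iter 1 (shift_endo f v) _) -poly_endo_XsubC expr1 -poly_endoM.
by rewrite -pq fp.
Qed.

End MinPoly.

Section FiniteDimension.
Variables (K : fieldType) (V : lmodType K).

Definition lin_basis n (e : 'I_n -> V) :=
  (forall x, exists u : 'I_n -> K, x = \sum_i u i *: e i) /\
  (forall u : 'I_n -> K, \sum_i u i *: e i = 0 -> forall i, u i = 0).

(** Translates between coordinates, the form of [Vector.axiom], and bases, the form that can be
    lifted from a fibre. *)
Lemma has_dimP n : has_dim V n <-> exists e : 'I_n -> V, lin_basis e.
Proof.
split=> [[[h lh [g hK gK]]]|[e [espan efree]]].
  pose H : {linear V -> 'rV[K]_n} := HB.pack h (GRing.isLinear.Build K V _ *:%R h lh).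
  have hsum (u : 'I_n -> K) :
      h (\sum_i u i *: g (delta_mx 0 i)) = \row_i u i.
    rewrite -[h]/(H : _ -> _) linear_sum [RHS]row_sum_delta.
    by apply: eq_bigr => i _; rewrite linearZ /= gK mxE.
  exists (fun i => g (delta_mx 0 i)); split=> [x|u /(congr1 h)].
    exists (h x 0); apply: (can_inj hK); rewrite hsum.
    by apply/rowP => i; rewrite mxE.
  rewrite hsum -[h]/(H : _ -> _) linear0 => /rowP e i.
  by have := e i; rewrite !mxE.
have /choice[h hE] := espan.
pose c x := \row_i h x i.
have hu (u : 'I_n -> K) : c (\sum_i u i *: e i) = \row_i u i.
  apply/rowP => i; rewrite !mxE; apply/eqP; rewrite -subr_eq0; apply/eqP; move: i.
  apply: efree; rewrite -[RHS](subrr (\sum_i u i *: e i)) [X in _ = X - _]hE -sumrB.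
  by apply: eq_bigr => i _; rewrite scalerBl.
split; exists c => [k x y|].
  rewrite {1}[x]hE {1}[y]hE scaler_sumr -big_split /=.
  rewrite (eq_bigr (fun i => (k * h x i + h y i) *: e i)) => [|i _].
    by rewrite hu; apply/rowP => i; rewrite !mxE.
  by rewrite scalerDl scalerA.
exists (fun r : 'rV_n => \sum_i r 0 i *: e i) => [x|r].
  by rewrite [RHS]hE; apply: eq_bigr => i _; rewrite mxE.
by rewrite hu; apply/rowP => i; rewrite mxE.
Qed.

(** A family of maximal length whose images under h are independent is a basis: a vector whose image
    lies outside their row space could be adjoined. *)
Lemma has_dim_sub m (h : V -> 'rV[K]_m) : linear h -> injective h ->
  exists n, has_dim V n.
Proof.
move=> lh hI.
pose H : {linear V -> 'rV[K]_m} := HB.pack h (GRing.isLinear.Build K V _ *:%R h lh).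
pose good r := `[< exists e : 'I_r -> V, row_free (\matrix_i h (e i)) >].
have ex : exists r, good r.
  by exists 0%N; apply/asboolP; exists (fun=> 0); rewrite -row_leq_rank.
have bound r : good r -> (r <= m)%N.
  by move=> /asboolP[e /eqP <-]; apply: rank_leq_col.
case: (ex_maxnP ex bound) => r /asboolP[e efree] rmax.
have hsum (u : 'rV_r) : h (\sum_i u 0 i *: e i) = u *m \matrix_i h (e i).
  rewrite -[h]/(H : _ -> _) linear_sum mulmx_sum_row.
  by apply: eq_bigr => i _; rewrite linearZ /= rowK.
exists r; apply/has_dimP; exists e; split=> [x|u eu i].
  suff /submxP[u hu] : (h x <= \matrix_i h (e i))%MS.
    by exists (u 0); apply: hI; rewrite hsum.
  apply: contraT => nx; suff: (r.+1 <= r)%N by rewrite ltnn.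
  apply: rmax; apply/asboolP.
  (* The family e with x put in front. *)
  exists (fun i => oapp e x (unlift ord0 i)); apply: inj_row_free => w.
  rewrite mulmx_sum_row big_ord_recl rowK unlift_none /=.
  pose w' := \row_i w 0 (lift ord0 i).
  under eq_bigr => i _ do rewrite rowK liftK /=.
  have -> : \sum_(i < r) w 0 (lift ord0 i) *: h (e i) = w' *m \matrix_i h (e i).
    by rewrite mulmx_sum_row; apply: eq_bigr => i _; rewrite mxE rowK.
  (* If the coefficient of x is zero, independence of e concludes; otherwise the relation can be
     solved for h x, against [nx]. *)
  have [w0|w0] := eqVneq (w 0 ord0) 0.
    rewrite w0 scale0r add0r -(mul0mx _ (\matrix_i h (e i))).
    move=> /(row_free_inj efree)/rowP w'0; apply/rowP => i; rewrite mxE.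
    case: (unliftP ord0 i) => [j ->|->//].
    by have := w'0 j; rewrite !mxE.
  move=> /eqP; rewrite addr_eq0 => /eqP e0; case/negP: nx; apply/submxP.
  exists (- (w 0 ord0)^-1 *: w'); rewrite -scalemxAl scaleNr -scalerN -e0.
  by rewrite scalerA mulVf ?scale1r.
have /rowP/(_ i) : \row_i u i = 0.
  apply: (row_free_inj efree); rewrite mul0mx -hsum.
  transitivity (h (\sum_i u i *: e i)); last by rewrite eu -[h]/(H : _ -> _) linear0.
  by congr h; apply: eq_bigr => j _; rewrite mxE.
by rewrite !mxE.
Qed.

(** The Cayley-Hamilton theorem, read through coordinates. *)
Lemma annihilating_poly (f : {linear V -> V}) n : has_dim V n ->
  exists2 p, p != 0 & annihilates f p.
Proof.
move=> [[h lh [g hK gK]]].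
pose H : {linear V -> 'rV[K]_n} := HB.pack h (GRing.isLinear.Build K V _ *:%R h lh).
(* [horner_mx] works with matrices of positive size; in dimension 0 the polynomial 1 annihilates. *)
case: n => [|n] in h lh g hK gK H *.
  exists 1; rewrite ?oner_neq0 // => x; apply: (can_inj hK).
  by apply/rowP; case.
have lg : linear g.
  by move=> c x y; apply: (can_inj hK); rewrite lh !gK.
pose G : {linear 'rV[K]_n.+1 -> V} := HB.pack g (GRing.isLinear.Build K _ V *:%R g lg).
pose A := lin1_mx (H \o f \o G).
have hA p x : h (poly_endo f p x) = h x *m horner_mx A p.
  elim/poly_ind: p x => [|p c IH] x.
    by rewrite poly_endo0 rmorph0 mulmx0 -[h]/(H : _ -> _) linear0.
  rewrite poly_endoD poly_endoMX poly_endoC addrC -[h]/(H : _ -> _) linearP /= IH.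
  rewrite mulrC rmorphD rmorphM /= horner_mx_X horner_mx_C mulmxDr mul_mx_scalar addrC.
  by rewrite mulmxA mul_rV_lin1 /= hK.
exists (char_poly A) => [|x]; first exact: monic_neq0 (char_poly_monic _).
by apply: (can_inj hK); rewrite hA Cayley_Hamilton mulmx0 -[h]/(H : _ -> _) linear0.
Qed.
End FiniteDimension.

(** * Spectral subspaces of a quotient *)

Section Quotient.
Variables (K : fieldType) (V : lmodType K) (f : {linear V -> V}).
Variables (W : submod V) (fW : forall x, x \in W -> f x \in W).

Lemma quot_pi_eq0 x : quot_pi W x = 0 <-> x \in W.
Proof. by rewrite -(linear0 (quot_pi W)) quot_pi_eq subr0. Qed.

Lemma quot_endo_poly p x :
  poly_endo (quot_endo fW) p (quot_pi W x) = quot_pi W (poly_endo f p x).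
Proof.
elim/poly_ind: p x => [|p c IH] x; first by rewrite !poly_endo0 linear0.
have e : quot_endo fW (quot_pi W x) = quot_pi W (f x) by exact: quot_endo_pi.
rewrite !poly_endoD !poly_endoMX !poly_endoC e IH.
by rewrite [RHS]linearD linearZ.
Qed.

Lemma spectral_quotP v x :
  quot_pi W x \in spectral_subspace (quot_endo fW) v <-> x \in torsion fW v.
Proof.
have e k : iter k (shift_endo (quot_endo fW) v) (quot_pi W x) = 0 <->
    iter k (shift_endo f v) x \in W.
  by rewrite -!poly_endo_XsubC quot_endo_poly quot_pi_eq0.
by split=> /asboolP[k hk]; apply/asboolP; exists k; apply/e.
Qed.

Lemma annihilates_quot p : annihilates (quot_endo fW) p ->
  forall x, poly_endo f p x \in W.
Proof. by move=> h x; apply/quot_pi_eq0; rewrite -quot_endo_poly h. Qed.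

Variables (V' : lmodType K) (f' : {linear V' -> V'}).
Variables (W' : submod V') (fW' : forall x, x \in W' -> f' x \in W').
Variables (j : {linear V' -> V}) (v : K).
Hypothesis jf : forall x, j (f' x) = f (j x).
Hypothesis jW : forall x, (j x \in W) = (x \in W').
Hypothesis j_torsion : forall x, j x \in torsion fW v.
Hypothesis j_lift : forall x, x \in torsion fW v -> exists y, x - j y \in W.

Definition quot_spectral (x : quot_lmod W') :
    sub_lmod (spectral_subspace (quot_endo fW) v) :=
  exist _ (quot_pi W (j (quot_repr x)))
    ((spectral_quotP v (j (quot_repr x))).2 (j_torsion (quot_repr x))).

Lemma val_quot_spectral x : val (quot_spectral (quot_pi W' x)) = quot_pi W (j x).
Proof.
by apply/quot_pi_eq; rewrite -linearB /= jW; apply/quot_pi_eq; rewrite quot_piK.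
Qed.

Fact quot_spectral_linear : linear quot_spectral.
Proof.
move=> c; elim/quot_ind=> x; elim/quot_ind=> y; apply: val_inj.
rewrite -linearP [LHS]val_quot_spectral [RHS]linearP.
rewrite linearP linearP; congr (_ *: _ + _); exact: esym (val_quot_spectral _).
Qed.

(** [jW] makes the map independent of representatives and injective, [j_lift] makes it surjective,
    and [jf] makes it commute with the endomorphisms. *)
Lemma quot_spectral_iso :
  exists phi : {linear quot_lmod W' -> sub_lmod (spectral_subspace (quot_endo fW) v)},
    bijective phi /\
    forall x, val (phi (quot_endo fW' x)) = quot_endo fW (val (phi x)).
Proof.
have inj : injective quot_spectral.
  elim/quot_ind=> x; elim/quot_ind=> y /(congr1 val); rewrite !val_quot_spectral.
  by move=> /quot_pi_eq; rewrite -linearB /= jW => h; apply/quot_pi_eq.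
have surj y : exists x, quot_spectral x = y.
  case: y => y; elim/quot_ind: y => y ys.
  have [x xy] := j_lift ((spectral_quotP _ _).1 ys).
  exists (quot_pi W' x); apply: val_inj; rewrite val_quot_spectral /=.
  by apply/esym/quot_pi_eq.
have /choice[h hK] := surj.
pose phi : {linear quot_lmod W' -> sub_lmod (spectral_subspace (quot_endo fW) v)} :=
  HB.pack quot_spectral (GRing.isLinear.Build K _ _ *:%R quot_spectral quot_spectral_linear).
exists phi; split; first by exists h => // x; apply: inj; rewrite hK.
have e x : val (phi (quot_pi W' x)) = quot_pi W (j x) by exact: val_quot_spectral.
elim/quot_ind=> x; have -> : quot_endo fW' (quot_pi W' x) = quot_pi W' (f' x).
  exact: quot_endo_pi.
by rewrite !e jf; apply/esym; exact: quot_endo_pi.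
Qed.

End Quotient.

(** * The completed algebra *)

Lemma rmorph_ab_rel (A B : pzRingType) (f : {rmorphism A -> B}) x y :
  f (x * y - y * x - y ^+ 2) = f x * f y - f y * f x - f y ^+ 2.
Proof. by rewrite !rmorphB !rmorphM. Qed.

Section UniversalProperty.
Variables (K : fieldType) (S : nzRingType) (f : {rmorphism K -> S}) (x y : S).
Hypothesis fx : forall c, GRing.comm (f c) x.
Hypothesis fy : forall c, GRing.comm (f c) y.
Hypothesis xyE : x * y - y * x = y ^+ 2.

Definition word_eval (m : {fmonom bool}) : S :=
  \prod_(l <- (m : seq bool)) (if l then y else x).

Fact word_eval_monoid : mmorphism word_eval.
Proof. by split=> [m n|]; rewrite /word_eval ?fmM ?fm1 ?big_cat ?big_nil. Qed.
HB.instance Definition _ :=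
  isMultiplicative.Build {fmonom bool} S word_eval word_eval_monoid.

Definition free_eval : {malg K[{fmonom bool}]} -> S := mmap f word_eval.
HB.instance Definition _ := GRing.Additive.on free_eval.

(** S need not be commutative; multiplicativity comes from scalars commuting with the values of
    words. *)
Lemma free_eval_monoid : monoid_morphism free_eval.
Proof.
have cm (g : {malg K[{fmonom bool}]}) m m' : GRing.comm (f g@_m) (word_eval m').
  rewrite /word_eval; elim: (m' : seq bool) => [|l s IH].
    by rewrite big_nil; apply: GRing.commr1.
  by rewrite big_cons; apply: GRing.commrM => //; case: l.
by split; [exact: mmap1|exact: (commr_mmap_is_multiplicative cm).1].
Qed.
HB.instance Definition _ := GRing.isMonoidMorphism.Build
  {malg K[{fmonom bool}]} S free_eval free_eval_monoid.

Lemma free_evalU l : free_eval << fmu l >> = if l then y else x.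
Proof. by rewrite /free_eval mmapU /= rmorph1 mul1r /word_eval fmU big_seq1. Qed.

Fact free_eval_ker_closed : zmod_closed [pred g | free_eval g == 0].
Proof.
split=> [|g h]; rewrite !inE ?raddf0 // => /eqP g0 /eqP h0.
by rewrite raddfB /= g0 h0 subr0.
Qed.

Fact free_eval_kerMl g h : free_eval h == 0 -> free_eval (g * h) == 0.
Proof. by move=> /eqP h0; rewrite rmorphM /= h0 mulr0. Qed.

Fact free_eval_kerMr g h : free_eval h == 0 -> free_eval (h * g) == 0.
Proof. by move=> /eqP h0; rewrite rmorphM /= h0 mul0r. Qed.

Definition free_eval_ker : ideal2 {malg K[{fmonom bool}]} :=
  Ideal2 free_eval_ker_closed free_eval_kerMl free_eval_kerMr.

Definition ab_eval (t : ab_alg K) : S := free_eval (ringquot_repr t).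

Lemma ab_eval_pi g : ab_eval (ab_pi g) = free_eval g.
Proof.
apply/eqP; rewrite -subr_eq0 -raddfB /=.
(* The kernel of [free_eval] is a two-sided ideal containing the relation, hence contains
   [ab_ideal]. *)
suff : ringquot_repr (ab_pi g) - g \in ab_ideal K.
  move=> /asboolP/(_ free_eval_ker); apply; rewrite inE.
  by apply/eqP; rewrite [LHS]rmorph_ab_rel /= !free_evalU xyE subrr.
by apply/ringquot_pi_eq; rewrite ringquot_piK.
Qed.

Fact ab_eval_zmod : zmod_morphism ab_eval.
Proof.
elim/ringquot_ind=> g; elim/ringquot_ind=> h.
by rewrite -[_ - _](raddfB (@ab_pi K)) !ab_eval_pi raddfB.
Qed.
HB.instance Definition _ :=
  GRing.isZmodMorphism.Build (ab_alg K) S ab_eval ab_eval_zmod.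

Fact ab_eval_monoid : monoid_morphism ab_eval.
Proof.
split; first by rewrite -(rmorph1 (@ab_pi K)) ab_eval_pi rmorph1.
elim/ringquot_ind=> g; elim/ringquot_ind=> h.
by rewrite -[_ * _](rmorphM (@ab_pi K)) !ab_eval_pi rmorphM.
Qed.
HB.instance Definition _ :=
  GRing.isMonoidMorphism.Build (ab_alg K) S ab_eval ab_eval_monoid.

Lemma ab_eval_cst c : ab_eval (ab_cst c) = f c.
Proof. by rewrite ab_eval_pi /free_eval mmapC. Qed.

Lemma ab_universal : exists rho : {rmorphism ab_alg K -> S},
  (forall c, rho (ab_cst c) = f c) /\ rho (ab_b K) = y.
Proof.
exists [the {rmorphism ab_alg K -> S} of ab_eval]; split; first exact: ab_eval_cst.
by rewrite /= ab_eval_pi free_evalU.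
Qed.

End UniversalProperty.

(** * A matrix representation that reads off coefficients *)

Section MatrixModel.
Variables (K : fieldType) (n : nat).

Definition shift_mx (c : nat -> K) : 'M[K]_n.+1 :=
  \matrix_(i, j) (if (i == j.+1 :> nat) then c j else 0).

Lemma shift_mxM c d i j :
  (shift_mx c * shift_mx d) i j = if (i == j.+2 :> nat) then c j.+1 * d j else 0.
Proof.
rewrite mxE; case: eqP => [ij|ij].
  have lt : (j.+1 < n.+1)%N by rewrite -ij ltnW.
  rewrite (bigD1 (Ordinal lt)) //= !mxE ij !eqxx big1 ?addr0 // => k kj.
  rewrite !mxE [k == j.+1 :> nat](negPf kj) ?mulr0 //.
rewrite big1 // => k _; rewrite !mxE; case: eqP => [ik|]; rewrite ?mul0r //.
by case: eqP => [kj|]; [rewrite ik kj in ij|rewrite mulr0].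
Qed.

(* The matrices of multiplication by b and of a = b^2 d/db on K[b]/(b^(n+1)), in
   the basis of powers of b. *)
Definition b_mx := shift_mx (fun=> 1).
Definition a_mx := shift_mx (fun j => j%:R).

Lemma ab_mx : a_mx * b_mx - b_mx * a_mx = b_mx ^+ 2.
Proof.
apply/matrixP => i j; rewrite mxE [fun_of_matrix (- _) i j]mxE !shift_mxM.
case: eqP => _; last by rewrite subr0.
by rewrite mulr1 mul1r -natr1 addrAC subrr add0r mulr1.
Qed.

Lemma b_mxX_low k (Y : 'M[K]_n.+1) (i j : 'I_n.+1) : (i < k)%N -> (b_mx ^+ k * Y) i j = 0.
Proof.
elim: k i => // k IH i ik; rewrite exprS -mulrA mxE big1 // => l _.
rewrite mxE; case: eqP => [il|]; last by rewrite mul0r.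
by rewrite IH ?mulr0 // -ltnS -il.
Qed.

Lemma b_mxX_col0 k (i : 'I_n.+1) : (b_mx ^+ k) i 0 = (i == k :> nat)%:R.
Proof.
elim: k i => [|k IH] i; first by rewrite mxE.
rewrite exprS mxE; case: eqP => [ik|ik].
  have lt : (k < n.+1)%N by rewrite -ltnS -ik ltnW // ltnS.
  rewrite (bigD1 (Ordinal lt)) //= mxE IH ik !eqxx mulr1 big1 ?addr0 // => l.
  by rewrite -val_eqE /= IH => /negPf ->; rewrite mulr0.
rewrite big1 // => l _; rewrite IH mxE; case: eqP => [il|]; rewrite ?mul0r //.
by case: eqP => [lk|]; [rewrite il lk in ik|rewrite mulr0].
Qed.

End MatrixModel.

Section Completion.
Variable K : fieldType.
Local Notation At := (ab_compl K).
Implicit Types (c d : nat -> K).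

Lemma cauchy_lim_eq (u v : cauchy_seq K) :
  (forall k, exists N, forall n, (N <= n)%N -> val u n - val v n \in filt K k) ->
  cauchy_lim u = cauchy_lim v.
Proof. by move=> h; apply/ringquot_pi_eq/asboolP. Qed.

Lemma bX_filt k (x : ab_alg K) : ab_b K ^+ k * x \in filt K k.
Proof. by apply/asboolP; exists x. Qed.

(* In the matrix model the first column of c_0 + c_1 b + ... is (c_0, c_1, ...). *)
Lemma pseries_eq0 c : pseries c = 0 -> forall i, c i = 0.
Proof.
move=> c0 i; have : cauchy_lim (CauchySeq (pseries_cauchy c)) = cauchy_lim 0.
  by rewrite rmorph0.
(* A multiple of b^(i+1) has zero entries in row i, and a partial sum of at least i+1 terms contains
   the coefficient c i. *)
move=> /ringquot_pi_eq; rewrite subr0 => /asboolP/(_ i.+1)[N /(_ (maxn N i.+1))].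
rewrite leq_maxl => /(_ isT)/asboolP[y /= cy].
have cM (A : 'M[K]_i.+1) k : GRing.comm (scalar_mx k) A := esym (scalar_mxC k A).
have [rho [rc rb]] := @ab_universal K 'M[K]_i.+1 (@scalar_mx K i.+1)
  _ _ (cM (a_mx K i)) (cM (b_mx K i)) (ab_mx K i).
have := congr1 (fun t => rho t ord_max 0) cy; rewrite !rmorphM rmorphXn /= rb.
rewrite b_mxX_low // rmorph_sum summxE => <-.
have lt : (i < maxn N i.+1)%N by rewrite leq_maxr.
have ent m : rho (ab_cst (c m) * ab_b K ^+ m) ord_max 0 = c m * (i == m)%:R.
  rewrite rmorphM rmorphXn /= rb rc -mulmxE mul_scalar_mx mxE.
  by rewrite b_mxX_col0.
rewrite (bigD1 (Ordinal lt)) //= ent eqxx mulr1 big1 ?addr0 // => m mi.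
by rewrite ent [i == m]eq_sym [(m : nat) == i](negPf mi) mulr0.
Qed.

Lemma eq_pseries c d : c =1 d -> pseries c = pseries d.
Proof. by move=> cd; congr pseries; apply/funext. Qed.

Lemma pseries0 : pseries (fun=> 0 : K) = 0.
Proof.
rewrite -(rmorph0 (@cauchy_lim K)); congr cauchy_lim; apply: val_inj.
apply/funext => n /=; rewrite /pseries_sum big1 // => i _.
by rewrite rmorph0 mul0r.
Qed.

Lemma pseriesB c d : pseries (fun i => c i - d i) = pseries c - pseries d.
Proof.
rewrite -[_ - _](raddfB (@cauchy_lim K)); congr cauchy_lim; apply: val_inj.
apply/funext => n /=; rewrite /pseries_sum -[RHS]sumrB; apply: eq_bigr => i _.
by rewrite raddfB mulrBl.
Qed.

Lemma pseriesD c d : pseries (fun i => c i + d i) = pseries c + pseries d.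
Proof.
rewrite -[_ + _](raddfD (@cauchy_lim K)); congr cauchy_lim; apply: val_inj.
apply/funext => n /=; rewrite /pseries_sum -[RHS]big_split; apply: eq_bigr => i _.
by rewrite raddfD mulrDl.
Qed.

Lemma pseries_sum_recl c n :
  pseries_sum c n.+1 = ab_cst (c 0%N) + ab_b K * pseries_sum (fun i => c i.+1) n.
Proof.
rewrite /pseries_sum big_ord_recl mulr_sumr; congr (_ + _); first exact: mulr1.
by apply: eq_bigr => i _; rewrite mulrA -ab_cst_central -mulrA -exprS.
Qed.

Lemma pseries_recl c : pseries c = cA (c 0%N) + bA K * pseries (fun i => c i.+1).
Proof.
rewrite /cA /bA /= /to_compl -rmorphM -rmorphD; apply: cauchy_lim_eq => k.
exists k.+1 => -[//|n] nk.
(* With equally many terms in both partial sums, the right-hand side reaches one degree further; the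
   excess term lies in b^kA. *)
have -> : val (CauchySeq (pseries_cauchy c)) n.+1 - val (CauchySeq (cauchy_cst (ab_cst (c 0%N)))
    + CauchySeq (cauchy_cst (ab_b K)) * CauchySeq (pseries_cauchy (fun i => c i.+1))) n.+1
    = - (ab_b K * (ab_cst (c n.+1) * ab_b K ^+ n)).
  rewrite /= pseries_sum_recl [in X in _ - (_ + _ * X)]/pseries_sum big_ord_recr /=.
  by rewrite -/(pseries_sum _ _) mulrDr addrA opprD addrA subrr sub0r.
rewrite rpredN; do 2!apply: ideal2Ml.
by rewrite -[X in X \in _]mulr1 -(subnKC (nk : (k <= n)%N)) exprD -mulrA bX_filt.
Qed.

Lemma cA_pseries x : cA x = pseries (fun i => if i is 0%N then x else 0 : K).
Proof. by rewrite pseries_recl /= pseries0 mulr0 addr0. Qed.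

Lemma bAX_pseries k c :
  bA K ^+ k * pseries c = pseries (fun i => if (i < k)%N then 0 else c (i - k)%N).
Proof.
elim: k => [|k IH]; first by rewrite mul1r; apply: eq_pseries => i; rewrite subn0.
by rewrite exprS -mulrA IH [RHS]pseries_recl /= rmorph0 add0r.
Qed.

(** Reduces the action of the completion modulo b^kE to that of [ab_alg]. A late enough term of a
    Cauchy sequence serves as x, and the rest is a telescoping series divisible by b^k. *)
Lemma approx (t : At) k : exists x t', t = to_compl x + bA K ^+ k * t'.
Proof.
elim/ringquot_ind: t => u; rewrite -/(cauchy_lim u).
have /asboolP/choice[N hN] := valP u.
(* Along the subsequence [M i], the increments of [u] are multiples of [b ^ i];
   dividing them termwise by [b ^ k] avoids needing [b] to be a nonzerodivisor. *)
pose M i := (\max_(j < i.+1) N j)%N.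
have MN i : (N i <= M i)%N by exact: (@leq_bigmax _ (fun j : 'I_i.+1 => N j) ord_max).
have Mmono i j : (i <= j)%N -> (M i <= M j)%N.
  move=> ij; apply/bigmax_leqP => l _.
  exact: (@leq_bigmax _ (fun h : 'I_j.+1 => N h) (widen_ord (ij : (i.+1 <= j.+1)%N) l)).
have /choice[z hz] : forall i, exists z, val u (M i.+1) - val u (M i) = ab_b K ^+ i * z.
  move=> i; apply/asboolP/hN => //; exact: leq_trans (MN i) (Mmono _ _ (leqnSn i)).
pose T n := \sum_(i < n) ab_b K ^+ i * z (k + i)%N.
have cT : T \in @cauchy_pred K.
  apply/asboolP => m; exists m.
  have tail p q : (m <= p)%N -> (p <= q)%N -> T q - T p \in filt K m.
    move=> mp pq; rewrite /T -!(big_mkord xpredT (fun i => ab_b K ^+ i * z (k + i)%N)).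
    rewrite (big_cat_nat (leq0n p) pq) addrAC subrr add0r big_nat.
    apply: rpred_sum => i /andP[pi _].
    by rewrite -(subnKC (leq_trans mp pi)) exprD -mulrA bX_filt.
  move=> p q mp mq; case: (leqP q p) => [|/ltnW] pq; first exact: tail.
  by rewrite -opprB rpredN tail.
exists (val u (M k)), (cauchy_lim (CauchySeq cT)).
rewrite -[bA K ^+ k](rmorphXn (@to_compl K)) /= /to_compl -rmorphM -rmorphD.
apply: cauchy_lim_eq => m; exists (maxn m (N m)) => n; rewrite geq_max => /andP[mn Nn].
have tel : ab_b K ^+ k * T n = val u (M (k + n)%N) - val u (M k).
  rewrite mulr_sumr; elim: {mn Nn} n => [|n IH]; first by rewrite big_ord0 addn0 subrr.
  by rewrite big_ord_recr /= IH mulrA -exprD -hz addnS addrC subrKA.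
rewrite -[X in X \in _]/(val u n - (val u (M k) + ab_b K ^+ k * T n)) tel.
rewrite [X in _ - X]addrC subrK; apply: hN => //; apply: leq_trans (MN m) _.
by apply: Mmono; rewrite (leq_trans mn) ?leq_addl.
Qed.

End Completion.

(** * (a,b)-modules *)

Section Module.
Variables (K : fieldType) (E : lmodType (ab_compl K)).
Local Notation At := (ab_compl K).
Local Notation V := (vspace_of E).
Local Notation a := (act E (aA K)).
Local Notation b := (act E (bA K)).

Lemma act_abE (x : V) : a (b x) = b (a x + b x).
Proof.
suff e (y : E) : aA K *: (bA K *: y) = bA K *: (aA K *: y + bA K *: y) by exact: e.
by rewrite -scalerDl !scalerA (ore_rel (abA_rel K)).
Qed.

Lemma act_iter t k (x : V) : iter k (act E t) x = (t ^+ k : At) *: (x : E).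
Proof.
elim: k => [|k IH]; first by rewrite scale1r.
by rewrite iterS IH exprS -scalerA.
Qed.

Lemma act_shift v k (x : V) :
  iter k (shift_endo a v) x = (aA K - cA v) ^+ k *: (x : E).
Proof.
elim: k => [|k IH]; first by rewrite scale1r.
by rewrite iterS IH exprS -scalerA scalerBl.
Qed.

(** E and [vspace_of E] share their additive group; this only changes the type in which a sum is
    read. *)
Lemma sum_vspace n (F : 'I_n -> E) : \sum_i (F i : V) = \sum_i F i :> E.
Proof. by []. Qed.

Local Notation imE := (imb b).
Local Notation G := (spec act_abE).

Lemma imE_P k (x : E) : reflect (exists y : E, x = bA K ^+ k *: y) (x \in imE k).
Proof.
by apply: (iffP (imbP _ _ _)) => -[y ->]; exists y; rewrite act_iter.
Qed.

Lemma spec_scale v (t : At) (x : E) : x \in G v -> t *: x \in G v.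
Proof.
move=> xG.
have sub_alg (r : ab_alg K) y : y \in G v -> to_compl r *: (y : E) \in G v.
  elim/ab_alg_ind: r y => [c|||r r' hr hr'|r r' hr hr'] y yG.
  - exact: (rpredZ c yG).
  - exact: spec_a yG.
  - exact: (spec_iterb 1 yG).
  - rewrite rmorphD scalerDl; exact: rpredD (hr _ yG) (hr' _ yG).
  - by rewrite rmorphM -scalerA; apply/hr/hr'.
(* The approximation r depends on k; the error lies in b^kE, hence in the torsion at level k. *)
apply/specP => k; have [r [t' ->]] := approx t k.
rewrite scalerDl; apply: rpredD; first by have /specP/(_ k) h := sub_alg r x xG; exact: h.
by apply/sub_torsion/imE_P; exists (t' *: x); rewrite scalerA.
Qed.

Fact specE_closed v : GRing.submod_closed (G v : {pred E}).
Proof.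
split; first exact: (rpred0 (G v)).
move=> t x y xG yG; exact: rpredD (spec_scale t xG) yG.
Qed.

Definition specE v : submod E := Submod (specE_closed v).

(** Three consequences of freeness over K[[b]]. The first two pass to submodules, so they hold for
    G_v before a basis of it is known. *)
Definition b_regular := forall x : E, bA K *: x = 0 -> x = 0.
Definition b_separated := forall x : E,
  (forall k, exists y : E, x = bA K ^+ k *: y) -> x = 0.
Definition b_complete := forall y : nat -> E,
  exists X : nat -> E, forall k, X k = y k + bA K *: X k.+1.

Section Basis.
Variables (n : nat) (e : 'I_n -> E).
Hypothesis eP : pseries_basis e.

Lemma basis_pseries (x : E) : exists c : 'I_n -> nat -> K,
  x = \sum_i pseries (c i) *: e i.
Proof.
have [s hs ->] := eP.1 x; have /choice[c hc] := hs.
by exists c; apply: eq_bigr => i _; rewrite hc.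
Qed.

Lemma basis_free (c : 'I_n -> nat -> K) :
  \sum_i pseries (c i) *: e i = 0 -> forall i k, c i k = 0.
Proof.
move=> /(eP.2 (fun i => pseries (c i))) h i k.
by apply: pseries_eq0; apply: h => j; exists (c j).
Qed.

Lemma basis_regular : b_regular.
Proof.
move=> x bx; have [c ex] := basis_pseries x.
suff c0 i k : c i k = 0.
  by rewrite ex big1 // => i _; rewrite (eq_pseries (c0 i)) pseries0 scale0r.
(* The coefficients of b x: those of x moved up by one degree. *)
pose f i k := if (k < 1)%N then 0 else c i (k - 1)%N.
have <- : f i k.+1 = c i k by rewrite /f subn1.
apply: (basis_free (c := f)).
rewrite -[RHS]bx ex scaler_sumr; apply: eq_bigr => j _.
by rewrite -bAX_pseries expr1 scalerA.
Qed.

Lemma basis_separated : b_separated.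
Proof.
move=> x hx; have [c ex] := basis_pseries x.
suff c0 i k : c i k = 0.
  by rewrite ex big1 // => i _; rewrite (eq_pseries (c0 i)) pseries0 scale0r.
have [y] := hx k.+1; have [d ->] := basis_pseries y => ey.
(* The coefficients of x - b^(k+1) y, which is zero; up to degree k they are those of x. *)
pose f i j := c i j - (if (j < k.+1)%N then 0 else d i (j - k.+1)%N).
have <- : f i k = c i k by rewrite /f ltnSn subr0.
apply: (basis_free (c := f)).
rewrite -[RHS](subrr x) {1}ex ey scaler_sumr -sumrB; apply: eq_bigr => j _.
by rewrite pseriesB -bAX_pseries scalerBl scalerA.
Qed.

Lemma basis_complete : b_complete.
Proof.
move=> y; have /choice[c hc] := fun k => basis_pseries (y k).
(* The degree m coefficient of the sum of all b^j y (k+j); only j <= m contributes. *)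
pose C k i m := \sum_(j < m.+1) c (k + j)%N i (m - j)%N.
exists (fun k => \sum_i pseries (C k i) *: e i) => k.
rewrite {1}hc scaler_sumr -big_split; apply: eq_bigr => i _ /=.
rewrite scalerA -scalerDl; congr (_ *: _).
rewrite -[bA K]expr1 bAX_pseries -pseriesD; apply: eq_pseries => -[|m].
  by rewrite /C big_ord1 addn0 subn0 addr0.
rewrite /C big_ord_recl addn0 subn0 subn1; congr (_ + _).
by apply: eq_bigr => j _; rewrite addnS subSS.
Qed.

Lemma basis_fiber : has_dim (fiber E) n.
Proof.
apply/has_dimP; exists (fun i => quot_pi (bE E) (e i)); split=> [|u eu].
  elim/quot_ind => x; have [c ex] := basis_pseries x.
  exists (fun i => c i 0%N).
  under eq_bigr => i _ do rewrite -linearZ.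
  rewrite -linear_sum; apply/quot_pi_eq/asboolP.
  exists (\sum_i pseries (fun j => c i j.+1) *: e i).
  suff : x = \sum_i cA (c i 0%N) *: e i + bA K *: \sum_i pseries (fun j => c i j.+1) *: e i.
    by move=> h; apply/eqP; rewrite subr_eq addrC; apply/eqP; exact: h.
  rewrite {1}ex scaler_sumr -big_split; apply: eq_bigr => i _.
  by rewrite pseries_recl scalerDl scalerA.
have /quot_pi_eq : quot_pi (bE E) (\sum_i u i *: (e i : V)) = quot_pi (bE E) 0.
  by rewrite linear0 linear_sum -[RHS]eu; apply: eq_bigr => i _; rewrite linearZ.
rewrite subr0 => /asboolP[y].
have [d ->] := basis_pseries y => {}eu i.
(* The coefficients of a vanishing difference, a constant combination minus a multiple of b; in
   degree 0 they are u. *)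
pose f i j := (if j is 0%N then u i else 0) - (if (j < 1)%N then 0 else d i (j - 1)%N).
have <- : f i 0%N = u i by rewrite /f subr0.
apply: (basis_free (c := f)).
have h : \sum_i cA (u i) *: e i = bA K *: \sum_i pseries (d i) *: e i.
  by rewrite -sum_vspace; exact: eu.
transitivity (\sum_i cA (u i) *: e i - bA K *: \sum_i pseries (d i) *: e i).
  rewrite scaler_sumr -sumrB; apply: eq_bigr => j _.
  by rewrite pseriesB -cA_pseries -bAX_pseries expr1 scalerBl scalerA.
by rewrite h subrr.
Qed.

End Basis.

End Module.

(** * Lifting a basis of the fibre *)

Section LiftBasis.
Variables (K : fieldType) (E : lmodType (ab_compl K)).
Hypotheses (breg : b_regular E) (bsep : b_separated E).

Lemma fiber_pi_eq0 (x : E) : quot_pi (bE E) x = 0 <-> exists y : E, x = bA K *: y.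
Proof.
rewrite -(linear0 (quot_pi (bE E))) quot_pi_eq subr0.
by split=> [/asboolP|h]; [|apply/asboolP].
Qed.

Lemma quot_pi_sum n (u : 'I_n -> K) (g : 'I_n -> E) :
  quot_pi (bE E) (\sum_i cA (u i) *: g i) = \sum_i u i *: quot_pi (bE E) (g i).
Proof.
rewrite -sum_vspace linear_sum; apply: eq_bigr => i _.
have h : quot_pi (bE E) (u i *: (g i : vspace_of E)) = u i *: quot_pi (bE E) (g i).
  by rewrite linearZ.
  exact: h.
Qed.

Variables (n : nat) (g : 'I_n -> E).
Hypothesis gP : lin_basis (fun i => quot_pi (bE E) (g i)).

Lemma lift_step (x : E) : exists u : 'I_n -> K, exists y : E,
  x = \sum_i cA (u i) *: g i + bA K *: y.
Proof.
have [u eu] := gP.1 (quot_pi (bE E) x); exists u.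
have : quot_pi (bE E) (x - \sum_i cA (u i) *: g i) = 0.
  rewrite -[RHS](subrr (quot_pi (bE E) x)) {2}eu -quot_pi_sum.
  exact: (linearB (quot_pi (bE E))).
by move=> /fiber_pi_eq0[y ey]; exists y; rewrite -ey addrC subrK.
Qed.

Lemma lift_recl (c : 'I_n -> nat -> K) :
  \sum_i pseries (c i) *: g i = \sum_i cA (c i 0%N) *: g i
    + bA K *: \sum_i pseries (fun k => c i k.+1) *: g i.
Proof.
rewrite scaler_sumr -big_split; apply: eq_bigr => i _.
by rewrite pseries_recl scalerDl scalerA.
Qed.

Lemma lift_basis : pseries_basis g.
Proof.
split=> [x|s hs sg].
  have /choice[u /choice[y xE]] := lift_step.
  (* [y] sends a vector to its remainder after one division step, so degree k coefficients come from
     the k-th remainder. *)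
  pose c z i k := u (iter k y z) i.
  exists (fun i => pseries (c x i)) => [i|]; first by exists (c x i).
  apply/eqP; rewrite -subr_eq0; apply/eqP/bsep => k.
  (* The error of the expansion of x is b times the error for its remainder [y x], so it lies in
     every b^kE. *)
  elim: k x => [|k IH] x; first by exists (x - \sum_i pseries (c x i) *: g i); rewrite scale1r.
  have [t et] := IH (y x); exists t; rewrite exprS -scalerA -et {1}[x]xE lift_recl.
  rewrite opprD addrACA subrr add0r scalerBr; congr (_ - _ *: _).
  by apply: eq_bigr => i _; congr (_ *: _); apply: eq_pseries => j; rewrite /c iterSr.
have /choice[c hc] := hs.
(* Induction on the degree, for all relations at once: constant terms vanish modulo b, and
   cancelling b then leaves the relation between the shifted series. *)
suff c0 k (d : 'I_n -> nat -> K) : \sum_i pseries (d i) *: g i = 0 -> forall i, d i k = 0.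
  move=> i; rewrite hc -pseries0; apply: eq_pseries => k; apply: c0 i.
  by rewrite -[RHS]sg; apply: eq_bigr => i _; rewrite hc.
elim: k d => [|k IH] d; rewrite lift_recl => d0.
  apply: (gP.2 (fun i => d i 0%N)); rewrite -quot_pi_sum; apply/fiber_pi_eq0.
  exists (- \sum_i pseries (fun j => d i j.+1) *: g i).
  by apply/eqP; rewrite scalerN -addr_eq0 d0.
suff d00 : forall i, d i 0%N = 0.
  move: d0; rewrite big1 => [|i _]; last by rewrite d00 rmorph0 scale0r.
  by rewrite add0r => /breg; apply: (IH (fun i j => d i j.+1)).
apply: (gP.2 (fun i => d i 0%N)); rewrite -quot_pi_sum; apply/fiber_pi_eq0.
exists (- \sum_i pseries (fun j => d i j.+1) *: g i).
by apply/eqP; rewrite scalerN -addr_eq0 d0.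
Qed.

End LiftBasis.

Lemma has_rank_fiber (K : fieldType) (E : lmodType (ab_compl K)) n :
  b_regular E -> b_separated E -> has_dim (fiber E) n -> has_rank E n.
Proof.
move=> breg bsep /has_dimP[e eP]; exists (fun i => quot_repr (e i)).
apply: lift_basis => //; rewrite (_ : (fun i => _) = e) //.
by apply/funext => i; rewrite quot_piK.
Qed.

Lemma has_dim_bij (K : fieldType) (V V' : lmodType K) (f : {linear V -> V'}) n :
  bijective f -> has_dim V' n -> has_dim V n.
Proof.
move=> fb [[h lh hb]]; split; exists (h \o f); last exact: bij_comp.
by move=> c x y; rewrite /= linearP lh.
Qed.

Lemma has_dim_submod (K : fieldType) (V : lmodType K) (N : submod V) n :
  has_dim V n -> exists m, has_dim (sub_lmod N) m.
Proof.
move=> [[h lh hb]]; apply: (@has_dim_sub _ _ n (h \o val)).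
  by move=> c x y; exact: (lh c (val x) (val y)).
exact: inj_comp (bij_inj hb) val_inj.
Qed.

Section SubModule.
Variables (K : fieldType) (E : lmodType (ab_compl K)) (N : submod E).

Lemma b_regular_sub : b_regular E -> b_regular (sub_lmod N).
Proof. by move=> h x bx; apply/val_inj/h; have := congr1 val bx. Qed.

Lemma b_separated_sub : b_separated E -> b_separated (sub_lmod N).
Proof.
move=> h x hx; apply/val_inj/h => k; have [y ey] := hx k.
by exists (val y); have := congr1 val ey.
Qed.

Definition val_vspace (x : vspace_of (sub_lmod N)) : vspace_of E :=
  val (x : sub_lmod N).

Fact val_vspace_linear : linear val_vspace.
Proof. by []. Qed.
HB.instance Definition _ := GRing.isLinear.Build K
  (vspace_of (sub_lmod N)) (vspace_of E) *:%R val_vspace val_vspace_linear.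

(** This is where normality embeds N/bN into E/bE; it supplies the hypothesis [jW] of
    [quot_spectral_iso]. *)
Lemma normal_bE x : normal N -> (val_vspace x \in bE E) = (x \in bE (sub_lmod N)).
Proof.
move=> nN; apply/idP/idP => /asboolP[y ey]; apply/asboolP.
  have [|z zN ez] := (nN (val_vspace x)).1; first by split; [exact: (valP x)|exists y].
  by exists (exist _ z zN); apply: val_inj.
by exists (val_vspace y); rewrite ey.
Qed.

End SubModule.

(** * The decomposition of E *)

Section Decomposition.
Variables (K : fieldType) (E : lmodType (ab_compl K)).
Variables (n : nat) (e : 'I_n -> E).
Hypothesis eP : pseries_basis e.
Variable r : seq K.
Local Notation V := (vspace_of E).
Local Notation a := (act E (aA K)).
Local Notation b := (act E (bA K)).
Local Notation G := (specE E).
Local Notation s := (undup r).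
Local Notation mu := (minpoly (fiber_a E)).
(** The roots are listed with multiplicity: [undup r] is the list of eigenvalues, and
    [count_mem v r] is the exponent of X - v. *)
Hypothesis mu_split : mu = \prod_(z <- r) ('X - z%:P).

Lemma minpoly_fiber : is_minpoly (fiber_a E) mu.
Proof. exact/minpolyP/(annihilating_poly _ (basis_fiber eP)). Qed.

Lemma mem_eigen v : v \in s <-> is_eigenvalue (fiber_a E) v.
Proof. by rewrite (eigenvalue_root _ minpoly_fiber) mu_split root_prod_XsubC mem_undup. Qed.

Lemma act_b_inj : injective b.
Proof.
move=> x y xy; apply/eqP; rewrite -subr_eq0; apply/eqP/(basis_regular eP).
have : b (x - y) = 0 by rewrite -[RHS](subrr (b y)) -{1}xy; exact: linearB.
exact.
Qed.

Lemma act_b_sep (x : V) : (forall k, x \in imb b k) -> x = 0.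
Proof. by move=> hx; apply: (basis_separated eP) => k; apply/imE_P. Qed.

Lemma act_b_compl (y : nat -> V) :
  exists X : nat -> V, forall k, X k = y k + b (X k.+1).
Proof. exact: (basis_complete eP). Qed.

Lemma minpoly_imb (x : V) :
  poly_endo a (\prod_(v <- s) ('X - v%:P) ^+ count_mem v r) x \in imb b 1.
Proof.
have [_ /annihilates_quot/(_ x) h _] := minpoly_fiber; rewrite prodr_undup_exp_count -mu_split.
exact: h.
Qed.

Let su : uniq s := undup_uniq r.

Lemma specE_direct_sum : is_direct_sum s G.
Proof.
split.
  exact: (spec_split (act_abE (E := E)) act_b_sep act_b_compl su minpoly_imb).
exact: (spec_direct act_b_sep su).
Qed.

Lemma specE_normal v : v \in s -> normal (G v).
Proof.
move=> vs x; split=> [[xG [y ey]]|[y yG ->]].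
  exists y => //; rewrite ey in xG.
  exact: (spec_normal act_b_inj act_b_sep act_b_compl su minpoly_imb vs xG).
by split; [exact: spec_scale|exists y].
Qed.

(** [imb b 1] and [bE E] encode the same subspace; this passes between the general splitting and the
    fibre. *)
Lemma torsion_bE v (x : V) :
  x \in torsion (@imb_a _ _ _ _ (act_abE (E := E)) 1) v <->
  x \in torsion (@bE_stable _ E) v.
Proof. by split=> /asboolP h; apply/asboolP; exact: h. Qed.

Lemma specE_fiber v : v \in s -> fiber_iso_spectral (G v) v.
Proof.
move=> vs; pose j : {linear vspace_of (sub_lmod (G v)) -> V} := @val_vspace _ _ (G v).
apply: (@quot_spectral_iso _ _ _ _ (@bE_stable _ E) _ _ _
  (@bE_stable _ (sub_lmod (G v))) j v) => [//|x|x|x].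
- exact/normal_bE/specE_normal.
- apply/torsion_bE; have /specP/(_ 1%N) := valP (x : sub_lmod (G v)); exact.
move=> ht; have hx := (torsion_bE v x).2 ht.
have [y yG xy] := spec_lift act_b_sep act_b_compl su minpoly_imb vs hx.
by exists (exist _ y yG : sub_lmod (G v)).
Qed.

Lemma specE_shift v (x : E) : v \in s -> x \in G v -> exists2 y : E, y \in G v &
  (aA K - cA v) ^+ mup v mu *: x = bA K *: y.
Proof.
(* By normality it suffices to find y in E, that is, to argue modulo bE, where [iter_mup_mod]
   applies. *)
move=> vs xG; apply/(specE_normal vs); split; first exact: spec_scale.
have xt : (x : V) \in torsion (@bE_stable _ E) v.
  by apply/torsion_bE; have /specP/(_ 1%N) := xG; exact.
have [/monic_neq0 mu0 /annihilates_quot/(_ x) mux _] := minpoly_fiber.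
by have := iter_mup_mod mu0 mux xt; rewrite act_shift => /asboolP.
Qed.

(** The isomorphism carries the dimension of F_v to G_v/bG_v, and a basis of the latter lifts. *)
Lemma specE_rank v : v \in s -> exists2 m : nat,
  has_dim (sub_lmod (spectral_subspace (fiber_a E) v)) m &
  has_rank (sub_lmod (G v)) m.
Proof.
move=> vs; have [m dm] := has_dim_submod (spectral_subspace (fiber_a E) v) (basis_fiber eP).
exists m => //; have [phi [phib _]] := specE_fiber vs.
apply: has_rank_fiber (has_dim_bij phib dm).
  exact: b_regular_sub (basis_regular eP).
exact: b_separated_sub (basis_separated eP).
Qed.

End Decomposition.

Theorem theorem3p1p2 (R : realType) (E : lmodType (ab_compl R[i]))
    (hE : is_ab_module E) :
  exists G : R[i] -> submod E,
    (forall v : R[i], is_eigenvalue (fiber_a E) v ->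
       [/\ normal (G v),
           fiber_iso_spectral (G v) v,
           forall x : E, x \in G v ->
             exists2 y : E, y \in G v &
               (aA R[i] - cA v) ^+ mup v (minpoly (fiber_a E)) *: x
                 = bA R[i] *: y
         & exists2 n : nat,
             has_dim (sub_lmod (spectral_subspace (fiber_a E) v)) n &
             has_rank (sub_lmod (G v)) n]) /\
    (exists s : seq R[i],
       [/\ uniq s,
           forall v : R[i], v \in s <-> is_eigenvalue (fiber_a E) v
         & is_direct_sum s G]).
Proof.
have [n [e eP]] := hE.
(* The minimal polynomial splits because R[i] is algebraically closed; being monic, it equals the
   product over its roots. *)
have [r mu_split] := closed_field_poly_normal (minpoly (fiber_a E)).
have [/monicP mu1 _ _] := minpoly_fiber eP.
rewrite mu1 scale1r in mu_split.
have mem v := mem_eigen eP mu_split v.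
exists (specE E); split=> [v /mem vs|].
  split; [exact: (specE_normal eP mu_split)|exact: (specE_fiber eP mu_split)| |].
    by move=> x; apply: (specE_shift eP mu_split).
  exact: (specE_rank eP mu_split).
exists (undup r); split=> //; [exact: undup_uniq|exact: (specE_direct_sum eP mu_split)].
Qed.
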